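(* Let $\mathcal X: y^2+h(x)y=f(x)$ be a hyperelliptic curve of genus $g\ge2$ over $\mathbb F_q$ with unique point at infinity $P_\infty$ and hyperelliptic involution $\iota$. Let $t\ge g$, let $(u_A,v_A)$ be a reduced Mumford pair with $\deg u_A=g$, and let $(u_B,v_B)$ be a (semi-reduced) Mumford pair with $\deg u_B=t$. Assume $\gcd(u_A,u_B)=1$ and $\gcd(u_B,2v_B+h)=1$. Let $v_G,v_H$ be the polynomials modulo $u_Au_B$ (of degree $<g+t$) determined by \[ v_G\equiv v_A \pmod{u_A},\quad v_G\equiv v_B\pmod{u_B},\qquad v_H\equiv v_A\pmod{u_A},\quad v_H\equiv -v_B-h\pmod{u_B}, \] and set $G:=D_{(u_Au_B,v_G)}-P_\infty$, $H:=D_{(u_Au_B,v_H)}-P_\infty$. Let $\mathcal D$ be the sum of $2t$ distinct $\mathbb F_q$-rational points forming $t$ conjugate pairs $\{P_i,\iota(P_i)\}$, with support disjoint from $\operatorname{Supp}(G)\cup\operatorname{Supp}(H)\cup\{P_\infty\}$, and write $\operatorname{Supp}(\mathcal D)=\{R_1,\dots,R_{2t}\}$. Put $\alpha=[D_{(u_A,v_A)}-gP_\infty]$, $\beta=[D_{(u_B,v_B)}-tP_\infty]$, and $\gamma_I=[\sum_{i\in I}R_i-tP_\infty]$ in $J(\mathcal X)$ for $I\subseteq\{1,\dots,2t\}$ with $|I|=t$. Assume that for every subset $I\subseteq\{1,\dots,2t\}$ of size $t$ the reduced Mumford representatives of the classes \[ \alpha+\beta-\gamma_I\quad\text{and}\quad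 \alpha-\beta-\gamma_I \] have $u$-polynomials of degree $g$. Then $\mathcal C_{\mathcal L}(\mathcal D,G)$ and $\mathcal C_{\mathcal L}(\mathcal D,H)$ form a linear complementary pair of MDS codes. In particular, both codes have parameters $[2t,t,t+1]_q$.
   Context: $\mathbb F_q$ is a finite field, of any characteristic. $\mathcal X$ is the smooth projective curve of genus $g\ge2$ with affine equation $y^2+h(x)y=f(x)$, where $h,f\in\mathbb F_q[x]$, $f$ is monic of degree $2g+1$, $\deg h\le g$, and the affine curve is nonsingular over $\overline{\mathbb F}_q$; it has a single point at infinity $P_\infty$, which is $\mathbb F_q$-rational. The hyperelliptic involution is $\iota(x,y)=(x,-y-h(x))$, $\iota(P_\infty)=P_\infty$. $J(\mathcal X)=\mathrm{Pic}^0(\mathcal X)$ is the group of degree-zero $\mathbb F_q$-rational divisors modulo linear equivalence. A Mumford pair is $(u,v)\in\mathbb F_q[x]^2$ with $u$ monic, $\deg v<\deg u$ ($v=0$ if $u=1$), and $u\mid v^2+hv-f$; such pairs are also called semi-reduced, and a pair is reduced if $\deg u\le g$. It determines the effective affine $\mathbb F_q$-rational divisor $D_{(u,v)}=\sum_{\xi}m_\xi\,(\xi,v(\xi))$, where $\xi$ runs over the roots of $u$ in $\overline{\mathbb F}_q$ and $m_\xi$ is the multiplicity of $\xi$ in $u$; its degree is $\deg u$. Every class in $J(\mathcal X)$ equals $[D_{(u,v)}-(\deg u)P_\infty]$ for a unique reduced Mumford pair $(u,v)$, called its reduced Mumford representative; $u$ is its $u$-polynomial. For a divisor $\mathcal D=R_1+\dots+R_n$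 with $R_i$ distinct $\mathbb F_q$-rational points and a divisor $G$ with $\operatorname{Supp}(G)\cap\operatorname{Supp}(\mathcal D)=\emptyset$, the AG code is $\mathcal C_{\mathcal L}(\mathcal D,G)=\{(z(R_1),\dots,z(R_n)) : z\in\mathcal L(G)\}\subseteq\mathbb F_q^n$, where $\mathcal L(G)$ is the Riemann-Roch space. Two linear codes $\mathcal C_1,\mathcal C_2\subseteq\mathbb F_q^n$ form a linear complementary pair (LCP) if $\mathcal C_1\oplus\mathcal C_2=\mathbb F_q^n$. A code of length $n$, dimension $k$ and minimum distance $d$ has parameters $[n,k,d]_q$ and is MDS if $d=n-k+1$. *)

(* Defs.v *)
(* MathComp: mathcomp-classical is used for choice, and the freeg library of
   multinomials for divisors. *)
From HB Require Import structures.
From mathcomp Require Import all_boot all_order all_algebra.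
From mathcomp Require Import qpoly.
From mathcomp Require Import boolp classical_sets.
From mathcomp Require Import freeg.
From mathcomp Require Import ring.

Set Implicit Arguments.
Unset Strict Implicit.
Unset Printing Implicit Defensive.

Import Order.TTheory GRing.Theory Num.Theory.
Import Pdiv.Field.

Local Open Scope ring_scope.

Section Valuation.

Variables (k : fieldType) (K : comNzRingType) (cst : k -> K).

(* Normalized discrete valuations of K, trivial on k, when the ring K is a
   field; the value at 0 is irrelevant. *)
Definition discrete_valuation (v : K -> int) : Prop :=
  [/\ forall z w, z != 0 -> w != 0 -> v (z * w) = v z + v w,
      forall z w, z != 0 -> w != 0 -> z + w != 0 ->
        Num.min (v z) (v w) <= v (z + w),
      forall c : k, c != 0 -> v (cst c) = 0 &
      exists2 z, z != 0 & v z = 1].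

End Valuation.

Section ValuationTheory.

Variables (k : fieldType) (K : comNzRingType) (cst : {rmorphism k -> K}).
Variable v : K -> int.
Hypothesis vP : discrete_valuation cst v \/ v = fun=> 0.

Lemma cst_mul_neq0 a z : a != 0 -> z != 0 -> cst a * z != 0.
Proof.
move=> a0; apply: contra => /eqP az; apply/eqP.
by rewrite -[z]mul1r -(rmorph1 cst) -(mulVf a0) rmorphM -mulrA az mulr0.
Qed.

Lemma cst_neq0 a : a != 0 -> cst a != 0.
Proof. by move=> a0; rewrite -[cst a]mulr1 cst_mul_neq0 // oner_neq0. Qed.

Lemma val_cstM a z : a != 0 -> z != 0 -> v (cst a * z) = v z.
Proof.
move=> a0 z0; case: vP => [[vM _ vc _]|->] //.
by rewrite vM ?cst_neq0 // vc // add0r.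
Qed.

Lemma val_min z w : z != 0 -> w != 0 -> z + w != 0 ->
  Num.min (v z) (v w) <= v (z + w).
Proof.
by move=> z0 w0 zw0; case: vP => [[_ vD _ _]|->]; [exact: vD|rewrite minxx].
Qed.

Lemma val_lin (m : int) a z w : z = 0 \/ m <= v z -> w = 0 \/ m <= v w ->
  cst a * z + w = 0 \/ m <= v (cst a * z + w).
Proof.
have [-> _|a0] := eqVneq a 0; first by rewrite rmorph0 mul0r add0r.
have [-> _|z0] := eqVneq z 0; first by rewrite mulr0 add0r.
case=> [z0'|mz]; first by rewrite z0' eqxx in z0.
have [->|w0] := eqVneq w 0; first by rewrite addr0 val_cstM //; right.
case=> [w0'|mw]; first by rewrite w0' eqxx in w0.
have [->|s0] := eqVneq (cst a * z + w) 0; [by left|right].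
apply: le_trans (val_min (cst_mul_neq0 a0 z0) w0 s0).
by rewrite val_cstM // le_min mz.
Qed.

Lemma value_lin a z w c d :
  z = cst c \/ 0 < v (z - cst c) -> w = cst d \/ 0 < v (w - cst d) ->
  cst a * z + w = cst (a * c + d) \/ 0 < v (cst a * z + w - cst (a * c + d)).
Proof.
have E y e : y = cst e \/ 0 < v (y - cst e) <->
    y - cst e = 0 \/ 1 <= v (y - cst e).
  rewrite gtz0_ge1; split=> -[]; try by right.
    by move=> ->; left; rewrite subrr.
  by move/eqP; rewrite subr_eq0 => /eqP; left.
rewrite !E => zc wd.
rewrite (_ : _ - _ = cst a * (z - cst c) + (w - cst d)); first exact: val_lin.
by rewrite rmorphD rmorphM; ring.
Qed.

End ValuationTheory.

Fact frac_lin (K : fieldType) (c x y r s : K) : r != 0 -> s != 0 ->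
  (c * x * s + y * r) / (r * s) = c * (x / r) + y / s.
Proof. by move=> r0 s0; field; rewrite r0 s0. Qed.

Fact morph_lin (K K' : comNzRingType) (m : {rmorphism K -> K'}) c x x' y y' w :
  m c * (m x + m y * w) + (m x' + m y' * w) = m (c * x + x') + m (c * y + y') * w.
Proof. by rewrite !rmorphD !rmorphM; ring. Qed.

Fact span_elim (K : fieldType) (V : vectType K) (Q : V -> Prop) (s : seq V) x :
  Q 0 -> (forall a y z, Q y -> Q z -> Q (a *: y + z)) ->
  {in s, forall y, Q y} -> x \in span s -> Q x.
Proof.
move=> Q0 Qlin Qs /(@coord_span _ _ _ (in_tuple s)) ->.
elim/big_ind: _ => // [y z Qy Qz|i _]; first by rewrite -[y]scale1r; exact: Qlin.
by rewrite -[_ *: _]addr0; apply: Qlin => //; apply: Qs; rewrite mem_nth.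
Qed.

Section Curve.

(* L is an algebraic closure of F when iota is algebraic, i.e. when
   integralRange iota. *)
Variables (F : finFieldType) (L : closedFieldType) (iota : {rmorphism F -> L}).

Local Notation "p ^i" := (map_poly iota p) (at level 2, format "p ^i").

Variables h f : {poly F}.

Definition on_curve (p : L * L) : bool :=
  p.2 ^+ 2 + h^i.[p.1] * p.2 == f^i.[p.1].

(* degrees: deg h <= g and deg f = 2g + 1; the last clause says that the two
   partial derivatives of y^2 + h y - f have no common zero on the curve *)
Definition hyperelliptic (g : nat) : Prop :=
  [/\ (size h <= g.+1)%N,
      f \is monic,
      size f = (2 * g + 2)%N &
      forall a b : L, on_curve (a, b) ->
        ~ (2 * b + h^i.[a] = 0 /\ h^i^`().[a] * b - f^i^`().[a] = 0)].

(* L-points of the projective curve; None is the point at infinity *)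
Definition affine_point : Type := {p : L * L | on_curve p}.
Definition curve_point : Type := option affine_point.

Definition Pinf : curve_point := None.

(* Only meaningful when (a, b) is on the curve (otherwise it is Pinf). *)
Definition mkpoint (a b : L) : curve_point := insub (a, b).

Fact involution_subproof (p : affine_point) :
  on_curve ((val p).1, - (val p).2 - h^i.[(val p).1]).
Proof.
case: p => [[a b] /= ab]; move: ab; rewrite /on_curve /= => /eqP <-.
by apply/eqP; ring.
Qed.

Definition involution (P : curve_point) : curve_point :=
  if P is Some p then Some (Sub _ (involution_subproof p)) else Pinf.

Definition rational_point (P : curve_point) : Prop :=
  if P is Some p then exists a b : F, val p = (iota a, iota b) else True.

(* The function field L(X) = L(x)[y] / (y^2 + h y - f); this quotient ring is a
   field because f has odd degree > 2 deg h, so that curve_poly is irreducible. *)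

Definition base_field : fieldType := {fraction {poly L}}.

Definition curve_poly : {poly base_field} :=
  'X ^+ 2 + (tofrac h^i)%:P * 'X - (tofrac f^i)%:P.

Definition funfield := {poly %/ curve_poly}.

Definition of_x (r : base_field) : funfield := in_qpoly curve_poly r%:P.

Fact of_x_is_zmod_morphism : zmod_morphism of_x.
Proof. by move=> r s; rewrite /of_x !raddfB. Qed.

Fact of_x_is_monoid_morphism : monoid_morphism of_x.
Proof.
by split=> [|r s]; rewrite /of_x ?rmorphM //= ?in_qpolyM ?in_qpoly1.
Qed.

HB.instance Definition _ :=
  GRing.isZmodMorphism.Build base_field funfield of_x of_x_is_zmod_morphism.
HB.instance Definition _ :=
  GRing.isMonoidMorphism.Build base_field funfield of_x of_x_is_monoid_morphism.

Definition xX : funfield := of_x (tofrac 'X).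
Definition yX : funfield := in_qpoly curve_poly 'X.
Definition cst (c : L) : funfield := of_x (tofrac c%:P).

Fact cst_is_zmod_morphism : zmod_morphism cst.
Proof. by move=> a b; rewrite /cst !rmorphB. Qed.

Fact cst_is_monoid_morphism : monoid_morphism cst.
Proof. by split=> [|a b]; rewrite /cst ?rmorph1 // !rmorphM. Qed.

HB.instance Definition _ :=
  GRing.isZmodMorphism.Build L funfield cst cst_is_zmod_morphism.
HB.instance Definition _ :=
  GRing.isMonoidMorphism.Build L funfield cst cst_is_monoid_morphism.

(* elements of the subfield F(X) *)
Definition rational_fun (z : funfield) : Prop :=
  exists a b c : {poly F}, c != 0 /\
    z = of_x (tofrac a^i / tofrac c^i) + of_x (tofrac b^i / tofrac c^i) * yX.

(* P is the center of v on the smooth projective curve; the place at infinity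
   is the one where x has a pole. *)
Definition centered (P : curve_point) (v : funfield -> int) : Prop :=
  if P is Some p then
    let (a, b) := val p in
    0 < v (xX - cst a) /\ 0 < v (yX - cst b)
  else v xX < 0.

(* order of vanishing at P of a nonzero function *)
Definition ord (P : curve_point) : funfield -> int :=
  xget (fun=> 0) [set v | discrete_valuation cst v /\ centered P v]%classic.

(* z is regular at P with z(P) = c *)
Definition has_value (P : curve_point) (z : funfield) (c : L) : Prop :=
  z = cst c \/ 0 < ord P (z - cst c).

Definition divisor : Type := {freeg curve_point / int}.

(* Riemann-Roch space of F(X), for an F-rational divisor G *)
Definition RRspace (G : divisor) (z : funfield) : Prop :=
  rational_fun z /\ (z = 0 \/ forall P : curve_point, 0 <= ord P z + coeff P G).

(* Linear equivalence over F: for F-rational divisors of degree 0, this is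
   equality of the classes [D] and [E] in J(X). *)
Definition lin_equiv (D E : divisor) : Prop :=
  exists z : funfield,
    [/\ rational_fun z, z != 0 & forall P : curve_point, coeff P (D - E) = ord P z].

Definition mumford (u v : {poly F}) : Prop :=
  [/\ u \is monic, (size v < size u)%N & u %| v ^+ 2 + h * v - f].

Definition reduced_mumford (g : nat) (u v : {poly F}) : Prop :=
  mumford u v /\ (size u <= g.+1)%N.

(* the distinct roots in L of a nonzero polynomial *)
Definition roots (p : {poly L}) : seq L :=
  undup (sval (closed_field_poly_normal p)).

Definition mumford_div (u v : {poly F}) : divisor :=
  \sum_(xi <- roots u^i) << (mup xi u^i)%:Z *g mkpoint xi v^i.[xi] >>.

(* The reduced Mumford representative of the class of D. The default value
   (1, 0) is never reached when D is F-rational of degree 0; its u-polynomial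
   has degree 0. *)
Definition mumford_rep (g : nat) (D : divisor) : {poly F} * {poly F} :=
  xget (1, 0) [set uv | reduced_mumford g uv.1 uv.2 /\
    lin_equiv D (mumford_div uv.1 uv.2 - << (size uv.1).-1%:Z *g Pinf >>)]%classic.

Definition u_polynomial (g : nat) (D : divisor) : {poly F} :=
  (mumford_rep g D).1.

Definition is_codeword n (R : 'I_n -> curve_point) (G : divisor) (c : 'rV[F]_n) : Prop :=
  exists2 z, RRspace G z & forall j, has_value (R j) z (iota (c 0 j)).

(* The span only provides the type of subspaces: by AG_codeP below, nothing is
   added to the set of codewords. *)
Definition AG_code n (R : 'I_n -> curve_point) (G : divisor) : {vspace 'rV[F]_n} :=
  span [seq c <- enum 'rV[F]_n | `[< is_codeword R G c >]].

Lemma ordP P : discrete_valuation cst (ord P) \/ ord P = fun=> 0.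
Proof. by rewrite /ord; case: xgetP => [v _ [vv _]|_]; [left|right]. Qed.

Lemma rational_fun_lin (a : F) z w :
  rational_fun z -> rational_fun w -> rational_fun (cst (iota a) * z + w).
Proof.
move=> [p [q [r [r0 ->]]]] [p' [q' [r' [r'0 ->]]]].
exists (a%:P * p * r' + p' * r), (a%:P * q * r' + q' * r), (r * r').
rewrite mulf_neq0 //; split=> //.
have nz s : s != 0 -> tofrac s^i != 0.
  by move=> s0; rewrite tofrac_eq0 map_poly_eq0.
have E s s' : tofrac (a%:P * s * r' + s' * r)^i / tofrac (r * r')^i =
    tofrac (iota a)%:P * (tofrac s^i / tofrac r^i) + tofrac s'^i / tofrac r'^i.
  have -> : tofrac (a%:P * s * r' + s' * r)^i =
      tofrac (iota a)%:P * tofrac s^i * tofrac r'^i + tofrac s'^i * tofrac r^i.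
    by rewrite rmorphD !rmorphM /= map_polyC tofracD !tofracM.
  by rewrite rmorphM tofracM; exact: frac_lin (nz _ r0) (nz _ r'0).
by rewrite !E /cst; exact: (morph_lin of_x).
Qed.

Lemma RRspace_lin G (a : F) z w :
  RRspace G z -> RRspace G w -> RRspace G (cst (iota a) * z + w).
Proof.
have RRE y : (y = 0 \/ forall P, 0 <= ord P y + coeff P G) <->
    forall P, y = 0 \/ - coeff P G <= ord P y.
  split=> [[-> P|yP P]|yP]; [by left|by right; rewrite -subr_ge0 opprK|].
  have [->|y0] := eqVneq y 0; [by left|right=> P].
  by case: (yP P) => [y0'|]; [rewrite y0' eqxx in y0|rewrite -subr_ge0 opprK].
rewrite /RRspace !RRE => -[zF zG] [wF wG]; split; first exact: rational_fun_lin.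
by move=> P; apply: val_lin (ordP P) _ _ _ _ (zG P) (wG P).
Qed.

Lemma RRspace0 G : RRspace G 0.
Proof.
split; last by left.
by exists 0, 0, 1; rewrite oner_neq0 !rmorph0 !mul0r rmorph0 mul0r addr0.
Qed.

Lemma AG_codeP n (R : 'I_n -> curve_point) (G : divisor) (c : 'rV[F]_n) :
  c \in AG_code R G <-> is_codeword R G c.
Proof.
have lin a c1 c2 : is_codeword R G c1 -> is_codeword R G c2 ->
    is_codeword R G (a *: c1 + c2).
  move=> [z zG zc] [w wG wc]; exists (cst (iota a) * z + w).
    exact: RRspace_lin.
  by move=> j; rewrite !mxE rmorphD rmorphM; apply: value_lin (ordP _) _ _ _ _ _ (zc j) (wc j).
have zero : is_codeword R G 0.
  by exists 0; [exact: RRspace0|move=> j; left; rewrite mxE !rmorph0].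
split=> [|cw]; last first.
  by apply: memv_span; rewrite mem_filter mem_enum andbT; apply/asboolP.
apply: span_elim c zero lin _ => c.
by rewrite mem_filter => /andP[/asboolP].
Qed.

End Curve.

Section Codes.

Variables (F : finFieldType) (n : nat).
Implicit Types C : {vspace 'rV[F]_n}.

Definition hamming (c d : 'rV[F]_n) : nat := #|[set j | c 0 j != d 0 j]|.

Definition min_distance C (d : nat) : Prop :=
  (exists c1 c2, [/\ c1 \in C, c2 \in C, c1 != c2 & hamming c1 c2 = d]) /\
  (forall c1 c2, c1 \in C -> c2 \in C -> c1 != c2 -> (d <= hamming c1 c2)%N).

Definition parameters C (k d : nat) : Prop := \dim C = k /\ min_distance C d.

Definition MDS C : Prop :=
  exists k d, parameters C k d /\ d = (n - k + 1)%N.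

Definition LCP C1 C2 : Prop :=
  (C1 + C2)%VS = fullv /\ directv (C1 + C2).

End Codes.

(* Main.v *)
(* For a Mumford pair (u, v) with deg u >= g, the space L(D_(u,v) - Poo) consists
   of the functions (r + b y) / u with deg b < deg u - g and r = b (v + h) mod u:
   integral closedness of L[x, y] gives the shape of the numerator, regularity
   at the points conjugate to D_(u,v) gives the congruence, and the orders at
   infinity of the two terms, whose parities differ, give the degree bounds.
   Hence the space has dimension deg u - g, and it is 0 when deg u = g.

   A function of L(G) that vanishes at t of the points R_i, multiplied by the
   function that realizes the equivalence of alpha + beta - gamma_I with its
   reduced representative D' - g Poo, lies in L(D' - Poo) = 0 since deg D' = g;
   as dim L(G) = t, the code is MDS.  For H one also multiplies by u_B, whose
   divisor is D_B + iota(D_B) - 2t Poo.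

   If (r + b y) / u in L(G) and (r' + b' y) / u in L(H) agree at all R_i, then
   comparing conjugate points shows that b - b' and r - r' vanish at t distinct
   abscissas.  So b = b'; then r = r', since u_A divides r - r'; and finally u_B
   divides b (2 v_B + h), whence b = 0. *)
Require Import Defs.
From HB Require Import structures.
From mathcomp Require Import all_boot all_order all_algebra.
From mathcomp Require Import qpoly generic_quotient.
From mathcomp Require classical_sets.
From mathcomp Require Import boolp.
From mathcomp Require Import freeg.
From mathcomp Require Import ring lra zify.

Set Implicit Arguments.
Unset Strict Implicit.
Unset Printing Implicit Defensive.

Import Order.TTheory GRing.Theory Num.Theory.
Import Pdiv.Field.
Local Open Scope ring_scope.

(** * Discrete valuations *)

(** [ord P] is chosen among the normalized valuations centered at P, so only that description of it
    is known, and only once such a valuation exists. Each place is therefore treated twice: a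
    valuation is built there from an explicit formula, and then the orders of the elements A + B y
    are computed for an arbitrary valuation that fits the description. Normalization fixes the
    scale: because 1 is a value, x has order -2 at infinity and the local parameter at an affine
    point has order 1.

    Characteristic 2 is allowed, so squares cannot be completed. A point (a, b) is ramified over the
    x-line when 2 b + h(a) = 0, and there x - a has order 2 and y - b is the parameter; most local
    statements split along this alternative.

    Orders live over L while the codes live over F. Divisibility of polynomials does not depend on
    the field, and this brings the numerators r + b y back to F. *)

Section Valuations.

Variables (k : fieldType) (K : comNzRingType) (cst : {rmorphism k -> K}).
Hypothesis domK : forall z w : K, z * w = 0 -> z = 0 \/ w = 0.
Implicit Types (z w : K) (c : k) (m n : int).

Lemma dom_mul_neq0 z w : z != 0 -> w != 0 -> z * w != 0.
Proof. by move=> z0 w0; apply/eqP => /domK [] /eqP; apply/negP. Qed.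

Lemma dom_exp_neq0 z (n : nat) : z != 0 -> z ^+ n != 0.
Proof.
move=> z0; elim: n => [|n IH]; first by rewrite expr0 oner_neq0.
by rewrite exprS dom_mul_neq0.
Qed.

Lemma dom_mulI z (a b : K) : z != 0 -> z * a = z * b -> a = b.
Proof.
move=> z0 /eqP; rewrite -subr_eq0 -mulrBr => /eqP /domK [/eqP|/eqP].
  by rewrite (negPf z0).
by rewrite subr_eq0 => /eqP.
Qed.

Section Theory.

Variable v : K -> int.
Hypothesis vP : discrete_valuation cst v.

Lemma dvalM z w : z != 0 -> w != 0 -> v (z * w) = v z + v w.
Proof. by case: vP => + _ _ _; apply. Qed.

Lemma dval_cst c : c != 0 -> v (cst c) = 0.
Proof. by case: vP => _ _ + _; apply. Qed.

Lemma dval1 : v 1 = 0.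
Proof. by rewrite -(rmorph1 cst) dval_cst ?oner_neq0. Qed.

Lemma dvalN z : v (- z) = v z.
Proof.
have [->|z0] := eqVneq z 0; first by rewrite oppr0.
rewrite -mulN1r dvalM ?oppr_eq0 ?oner_neq0 // -(rmorph1 cst) -rmorphN.
by rewrite dval_cst ?add0r // oppr_eq0 oner_neq0.
Qed.

Lemma dvalX z (n : nat) : z != 0 -> v (z ^+ n) = v z *+ n.
Proof.
move=> z0; elim: n => [|n IH]; first by rewrite expr0 mulr0n dval1.
by rewrite exprS mulrS dvalM ?dom_exp_neq0 // IH.
Qed.

(** A lower bound on the order, with the convention that 0 has infinite order; the value of [v] at 0
    is arbitrary. *)
Definition vge (m : int) (z : K) : Prop := z = 0 \/ m <= v z.

Lemma vge0 m : vge m 0. Proof. by left. Qed.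

Lemma vge_neq0 m z : z != 0 -> vge m z -> m <= v z.
Proof. by move=> /negPf z0 [/eqP|//]; rewrite z0. Qed.

Lemma vgeW m n z : m <= n -> vge n z -> vge m z.
Proof. by move=> mn [->|nz]; [left|right; apply: le_trans nz]. Qed.

Lemma vgeN m z : vge m z -> vge m (- z).
Proof. by move=> [->|mz]; [left; rewrite oppr0|right; rewrite dvalN]. Qed.

Lemma vgeD m z w : vge m z -> vge m w -> vge m (z + w).
Proof.
move=> zm wm; have := @val_lin _ _ cst v (or_introl vP) m 1 z w zm wm.
by rewrite rmorph1 mul1r.
Qed.

Lemma vgeB m z w : vge m z -> vge m w -> vge m (z - w).
Proof. by move=> zm /vgeN; apply: vgeD. Qed.

Lemma vgeM m n z w : vge m z -> vge n w -> vge (m + n) (z * w).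
Proof.
have [-> _ _|z0] := eqVneq z 0; first by rewrite mul0r; left.
have [-> _ _|w0] := eqVneq w 0; first by rewrite mulr0; left.
move=> /(vge_neq0 z0) zm /(vge_neq0 w0) wn; right.
by rewrite dvalM // lerD.
Qed.

Lemma vge_cst c : vge 0 (cst c).
Proof.
by have [->|c0] := eqVneq c 0; [left; rewrite rmorph0|right; rewrite dval_cst].
Qed.

(** If z + w had order above v z, then z = (z + w) - w would too. *)
Lemma dval_addl z w : z != 0 -> vge (v z + 1) w -> z + w != 0 /\ v (z + w) = v z.
Proof.
move=> z0 zw; have zw0 : z + w != 0.
  apply/eqP => /eqP; rewrite addr_eq0 => /eqP e; move: zw; rewrite e dvalN.
  have w0 : w != 0 by move: z0; rewrite e oppr_eq0.
  by move/(vge_neq0 w0); rewrite gerDl.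
split=> //; apply/eqP; rewrite eq_le; apply/andP; split; last first.
  by apply: (vge_neq0 zw0); apply: vgeD; [right|apply: vgeW zw; rewrite lerDl].
rewrite -ltzD1 ltNge; apply/negP => zw1.
have /(vge_neq0 z0) : vge (v z + 1) z.
  by rewrite -[z in vge _ z](addrK w); apply: vgeB => //; right.
by rewrite gerDl.
Qed.

End Theory.

(** Orders are read off representations of z as a quotient, which are not unique. With the order
    given as a relation, independence of the representation becomes functionality of [rho]. By
    symmetry the ultrametric inequality is only asked for n <= m. *)
Lemma valuation_of_graph (rho : K -> int -> Prop) :
  (forall z, z != 0 -> exists n, rho z n) ->
  (forall z n m, z != 0 -> rho z n -> rho z m -> n = m) ->
  (forall z w n m, z != 0 -> w != 0 -> rho z n -> rho w m ->
    rho (z * w) (n + m)) ->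
  (forall z w n m l, z != 0 -> w != 0 -> z + w != 0 -> rho z n -> rho w m -> rho (z + w) l ->
    n <= m -> n <= l) ->
  (forall c, c != 0 -> rho (cst c) 0) ->
  (exists2 z, z != 0 & rho z 1) ->
  exists v, discrete_valuation cst v /\ forall z n, z != 0 -> rho z n -> v z = n.
Proof.
move=> ex fn mul ult cs [t t0 t1].
pose v z := classical_sets.xget 0 (rho z).
have vr z : z != 0 -> rho z (v z).
  by move=> /ex [n zn]; rewrite /v; case: classical_sets.xgetP => [m ->|/(_ n)].
have vE z n : z != 0 -> rho z n -> v z = n.
  by move=> z0; apply: fn => //; exact: vr.
exists v; split=> //; split.
- by move=> z w z0 w0; apply: vE; [exact: dom_mul_neq0|apply: mul => //; exact: vr].
- move=> z w z0 w0 zw0; rewrite ge_min.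
  have [zw|/ltW wz] := leP (v z) (v w).
    by rewrite (ult _ _ _ _ _ z0 w0 zw0 (vr _ z0) (vr _ w0) (vr _ zw0) zw).
  rewrite addrC in zw0 *.
  by rewrite (ult _ _ _ _ _ w0 z0 zw0 (vr _ w0) (vr _ z0) (vr _ zw0) wz) orbT.
- by move=> c c0; apply: vE (cs _ c0); rewrite fmorph_eq0.
- by exists t => //; apply: vE.
Qed.

End Valuations.

(** * Valuations of a hyperelliptic function field *)

Lemma ler_wnMn2l (e : int) (m n : nat) :
  e <= 0 -> (m <= n)%N -> e *+ n <= e *+ m.
Proof.
move=> e0 mn; rewrite -(subnK mn) mulrnDr gerDr -oppr_ge0 -mulNrn mulrn_wge0 //.
by rewrite oppr_ge0.
Qed.

Lemma mulrn_int (e : int) (m : nat) : e *+ m = e * m%:Z.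
Proof. by rewrite -mulr_natr natz. Qed.

(** Compares the orders of the two terms of A + B y at infinity, with e the order of x. Orders are
    doubled because that of y is e (2g + 1) / 2, and e is not yet known. *)
Lemma double_lt_of_mulrn (e x y : int) (m n : nat) :
  e < 0 -> x *+ 2 = e *+ m -> y *+ 2 = e *+ n -> (m < n)%N -> y + 1 <= x.
Proof.
move=> e0 xm yn mn; have : e *+ n <= e *+ m.+1 by rewrite ler_wnMn2l // ltW.
by move: xm yn; rewrite mulrSr; lia.
Qed.

(** The second equation makes e a divisor of 2, and the first one excludes e = -1 by parity. *)
Lemma eq_opp2_of_mulrn (e w : int) (c d m : nat) : e < 0 ->
  w *+ 2 = e *+ m.*2.+1 -> (e *+ c + 1) *+ 2 = e *+ d -> e = -2.
Proof.
rewrite !mulrn_int => e0 ew ed.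
have [i ei] : exists i : int, e * i = 2.
  by exists (d%:Z - c%:Z * 2); rewrite mulrBr -ed; ring.
have i0 : i < 0 by rewrite -(nmulr_rgt0 _ e0) ei.
have e2 : -2 <= e.
  by rewrite lerNl -ei -mulrNN ler_peMr //; lia.
have [e1|] := eqVneq e (-1); last by lia.
by move: ew; rewrite e1; lia.
Qed.

Section FunctionField.

Variables (L : closedFieldType) (K : comNzRingType).
Variables (X : {rmorphism {poly L} -> K}) (y : K) (h f : {poly L}) (g : nat).

Implicit Types (A B C : {poly L}) (z w : K).

Let sizeM (p q : {poly L}) : p != 0 -> q != 0 ->
  size (p * q) = (size p + size q).-1 := @size_mul _ p q.

Let sizeMleq (p q : {poly L}) : (size (p * q)%R <= (size p + size q).-1)%N :=
  size_polyMleq p q.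

Let sizeD (p q : {poly L}) : (size (p + q)%R <= maxn (size p) (size q))%N :=
  size_polyD p q.

Let sizeN (p : {poly L}) : size (- p) = size p := size_polyN p.

Hypothesis size_h : (size h <= g.+1)%N.
Hypothesis size_f : size f = (2 * g + 2)%N.
Hypothesis yE : y ^+ 2 + X h * y = X f.
Hypothesis X_free : forall A B, X A + X B * y = 0 -> A = 0 /\ B = 0.
Hypothesis X_inv : forall C, C != 0 -> exists w, X C * w = 1.

Definition fn A B : K := X A + X B * y.

Hypothesis X_denom :
  forall z, exists C A B, C != 0 /\ X C * z = fn A B.

Definition xcst : {rmorphism L -> K} := X \o polyC.

Lemma fnD A B A' B' : fn A B + fn A' B' = fn (A + A') (B + B').
Proof. by rewrite /fn !rmorphD; ring. Qed.

Lemma fnN A B : - fn A B = fn (- A) (- B).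
Proof. by rewrite /fn !rmorphN; ring. Qed.

Lemma fnB A B A' B' : fn A B - fn A' B' = fn (A - A') (B - B').
Proof. by rewrite fnN fnD. Qed.

Lemma fnM A B A' B' :
  fn A B * fn A' B' = fn (A * A' + B * B' * f) (A * B' + B * A' - B * B' * h).
Proof.
rewrite /fn !(rmorphD, rmorphB, rmorphM) -yE; ring.
Qed.

Lemma fnX A : X A = fn A 0.
Proof. by rewrite /fn rmorph0 mul0r addr0. Qed.

Lemma fnY : y = fn 0 1.
Proof. by rewrite /fn rmorph0 rmorph1 mul1r add0r. Qed.

Lemma fnZ C A B : X C * fn A B = fn (C * A) (C * B).
Proof. by rewrite /fn !rmorphM mulrDr mulrA. Qed.

Lemma fn0 : fn 0 0 = 0.
Proof. by rewrite /fn rmorph0 mul0r addr0. Qed.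

Lemma fn_inj A B A' B' : fn A B = fn A' B' -> A = A' /\ B = B'.
Proof.
move/eqP; rewrite -subr_eq0 fnB => /eqP /X_free [/eqP + /eqP].
by rewrite !subr_eq0 => /eqP -> /eqP ->.
Qed.

Lemma fn_eq0 A B : (fn A B == 0) = (A == 0) && (B == 0).
Proof.
apply/eqP/andP => [/X_free [-> ->]//|[/eqP -> /eqP ->]]; exact: fn0.
Qed.

Lemma X_eq0 C : (X C == 0) = (C == 0).
Proof. by rewrite fnX fn_eq0 eqxx andbT. Qed.

(** The norm of A + B y down to L(x); the conjugate of y is - y - h. *)
Definition nrm A B := A ^+ 2 - A * B * h - B ^+ 2 * f.

Lemma fn_conj A B : fn A B * fn (A - B * h) (- B) = X (nrm A B).
Proof. by rewrite fnM fnX /nrm; congr fn; ring. Qed.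

Lemma nrmM A B A' B' :
  nrm (A * A' + B * B' * f) (A * B' + B * A' - B * B' * h) = nrm A B * nrm A' B'.
Proof. by rewrite /nrm; ring. Qed.

(* minus the order at infinity of fn A B; the two degrees in the maximum have
   distinct parities *)
Definition delta A B : nat :=
  maxn (2 * (size A).-1) (if B == 0%R then 0 else 2 * (size B).-1 + 2 * g + 1)%N.

Lemma f_neq0 : f != 0.
Proof. by rewrite -size_poly_gt0 size_f addn2. Qed.

(** A^2 and B^2 f have degrees of different parity. The cross term A B h has degree at most deg A +
    deg B + g, which is below the mean of these two degrees and hence below the larger one. *)
Lemma size_nrm A B : fn A B != 0 -> size (nrm A B) = (delta A B).+1.
Proof.
rewrite fn_eq0 /nrm /delta => AB0; have f0 := f_neq0.
have sq p : p != 0 :> {poly L} -> size (p ^+ 2) = (2 * (size p).-1).+1.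
  move=> p0; have sp : (0 < size p)%N by rewrite size_poly_gt0.
  by rewrite expr2 sizeM //; lia.
have [B0|B0] := eqVneq B 0.
  rewrite B0 mulr0 mul0r expr0n /= mul0r !subr0 maxn0 sq //.
  by move: AB0; rewrite B0 eqxx andbT.
have sB : (0 < size B)%N by rewrite size_poly_gt0.
have sBf : size (B ^+ 2 * f) = (2 * (size B).-1 + 2 * g + 2)%N.
  by rewrite sizeM ?expf_neq0 // sq // size_f; lia.
have [A0|A0] := eqVneq A 0.
  by rewrite A0 expr0n /= !mul0r subrr sub0r sizeN sBf size_poly0 muln0 max0n !addnS !addn0.
have sA : (0 < size A)%N by rewrite size_poly_gt0.
have sABh : (size (A * B * h)%R <= (size A).-1 + (size B).-1 + g + 1)%N.
  have := sizeMleq (A * B) h; rewrite (sizeM A0 B0) => /leq_trans; apply.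
  by move: size_h; lia.
have [AB|BA] := ltnP (2 * (size B).-1 + 2 * g + 1) (2 * (size A).-1).
  rewrite -addrA size_polyDl ?sq //.
  rewrite -opprD sizeN.
  apply: leq_ltn_trans (sizeD _ _) _.
  rewrite gtn_max sBf; lia.
rewrite addrC size_polyDl sizeN sBf; first by lia.
apply: leq_ltn_trans (sizeD _ _) _.
rewrite gtn_max sizeN sq //; lia.
Qed.

Lemma nrm_neq0 A B : fn A B != 0 -> nrm A B != 0.
Proof. by move=> AB; rewrite -size_poly_eq0 size_nrm. Qed.

Lemma fn_unit A B : fn A B != 0 -> exists w, fn A B * w = 1.
Proof.
move=> /nrm_neq0 /X_inv [w nw]; exists (fn (A - B * h) (- B) * w).
by rewrite mulrA fn_conj.
Qed.

Lemma K_dom z w : z * w = 0 -> z = 0 \/ w = 0.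
Proof.
have [->|z0 zw] := eqVneq z 0; [by left|right].
have [C [A [B [C0 CE]]]] := X_denom z.
have /fn_unit [u AB] : fn A B != 0.
  apply/eqP => AB; have [r Cr] := X_inv C0.
  by move/eqP: z0; apply; rewrite -[z]mul1r -Cr -mulrA mulrCA CE AB mulr0.
by rewrite -[w]mul1r -AB -CE -mulrA mulrCA -(mulrA (X C)) zw !mulr0.
Qed.

(** * The place at infinity *)

Section Infinity.

Lemma delta_mul A B A' B' : fn A B != 0 -> fn A' B' != 0 ->
  delta (A * A' + B * B' * f) (A * B' + B * A' - B * B' * h) =
    (delta A B + delta A' B')%N.
Proof.
move=> AB AB'; apply: succn_inj; rewrite -size_nrm; last first.
  by rewrite -fnM (dom_mul_neq0 K_dom).
by rewrite nrmM sizeM ?nrm_neq0 // !size_nrm // addnS.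
Qed.

Lemma delta_scale C A B : C != 0 -> fn A B != 0 ->
  delta (C * A) (C * B) = (2 * (size C).-1 + delta A B)%N.
Proof.
move=> C0 AB; have CX : fn C 0 != 0 by rewrite -fnX X_eq0.
have := delta_mul CX AB; rewrite !mul0r !addr0 subr0 => ->; congr (_ + _)%N.
by rewrite /delta eqxx maxn0.
Qed.

Lemma delta_add A B A' B' : fn (A + A') (B + B') != 0 ->
  (delta (A + A') (B + B') <= maxn (delta A B) (delta A' B'))%N.
Proof.
move=> _; rewrite /delta.
have := sizeD A A'; have := sizeD B B'.
have [->|B0] := eqVneq B 0; have [->|B'0] := eqVneq B' 0;
  rewrite ?addr0 ?add0r ?eqxx ?(negPf B0) ?(negPf B'0) //; try lia.
by have [->|BB0] := eqVneq (B + B') 0; lia.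
Qed.

(** The expected order at infinity of (A + B y) / C, with x of order -2. *)
Let rho z (n : int) := exists C A B, [/\ C != 0, X C * z = fn A B &
  n = (2 * (size C).-1)%:Z - (delta A B)%:Z].

Lemma infinity_valuation_ex :
  exists v, discrete_valuation xcst v /\ v (X 'X) < 0.
Proof.
have nz C z A B : C != 0 -> z != 0 -> X C * z = fn A B -> fn A B != 0.
  by move=> C0 z0 <-; rewrite (dom_mul_neq0 K_dom) ?X_eq0.
have fun_rho z n m : z != 0 -> rho z n -> rho z m -> n = m.
  move=> z0 [C [A [B [C0 CE ->]]]] [C' [A' [B' [C'0 CE' ->]]]].
  have /fn_inj [EA EB] : fn (C' * A) (C' * B) = fn (C * A') (C * B').
    by rewrite -!fnZ -CE -CE' mulrCA.
  have := delta_scale C0 (nz _ _ _ _ C'0 z0 CE').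
  by rewrite -EA -EB (delta_scale C'0 (nz _ _ _ _ C0 z0 CE)); lia.
have [|||||v [vP vE]] := valuation_of_graph K_dom (cst := xcst) (rho := rho) _ fun_rho.
- by move=> z z0; have [C [A [B [C0 CE]]]] := X_denom z; eexists; exists C, A, B.
- move=> z w n m z0 w0 [C [A [B [C0 CE ->]]]] [C' [A' [B' [C'0 CE' ->]]]].
  exists (C * C'), (A * A' + B * B' * f), (A * B' + B * A' - B * B' * h).
  rewrite mulf_neq0 // delta_mul ?(nz _ _ _ _ C0 z0 CE) ?(nz _ _ _ _ C'0 w0 CE') //.
  split=> //; first by rewrite -fnM -CE -CE' rmorphM; ring.
  have : (0 < size C)%N by rewrite size_poly_gt0.
  have : (0 < size C')%N by rewrite size_poly_gt0.
  by rewrite sizeM //; lia.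
- move=> z w n m l z0 w0 zw0 [C [A [B [C0 CE ->]]]] [C' [A' [B' [C'0 CE' ->]]]] lP nm.
  have E : X (C * C') * (z + w) = fn (C' * A + C * A') (C' * B + C * B').
    by rewrite -fnD -!fnZ -CE -CE' rmorphM; ring.
  have CC0 : C * C' != 0 by rewrite mulf_neq0.
  have -> : l = (2 * (size (C * C')).-1)%:Z -
      (delta (C' * A + C * A') (C' * B + C * B'))%:Z.
    by apply: fun_rho zw0 lP _; exists (C * C'), (C' * A + C * A'), (C' * B + C * B').
  have := delta_add (nz _ _ _ _ CC0 zw0 E).
  rewrite (delta_scale C0 (nz _ _ _ _ C'0 w0 CE')) (delta_scale C'0 (nz _ _ _ _ C0 z0 CE)).
  have : (0 < size C)%N by rewrite size_poly_gt0.
  have : (0 < size C')%N by rewrite size_poly_gt0.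
  by rewrite sizeM //; set D := delta (C' * A + _) _; lia.
- move=> c c0; exists 1, c%:P, 0; split; rewrite ?oner_neq0 //.
    by rewrite rmorph1 mul1r -fnX.
  by rewrite size_poly1 /delta eqxx size_polyC c0.
(* The uniformizer is y / x^(g+1), of order 2 (g + 1) - (2g + 1) = 1. *)
- have [w wE] := X_inv (monic_neq0 (monicXn L g.+1)).
  have E : X ('X^(g.+1)) * (w * y) = fn 0 1 by rewrite mulrA wE mul1r fnY.
  exists (w * y).
    apply/eqP => w0; move/eqP: E; rewrite w0 mulr0 eq_sym fn_eq0.
    by rewrite oner_eq0 andbF.
  exists 'X^(g.+1), 0, 1; split; rewrite ?expf_neq0 ?polyX_eq0 //.
  by rewrite size_polyXn /delta oner_eq0 size_poly1 size_poly0; lia.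
exists v; split=> //; rewrite (vE _ (-2)) //; first by rewrite X_eq0 polyX_eq0.
exists 1, 'X, 0; split; rewrite ?oner_neq0 // ?rmorph1 ?mul1r ?fnX //.
by rewrite size_poly1 /delta eqxx size_polyX.
Qed.

Variable v : K -> int.
Hypothesis vP : discrete_valuation xcst v.
Hypothesis v_inf : v (X 'X) < 0.

Let Xx_neq0 : X 'X != 0. Proof. by rewrite X_eq0 polyX_eq0. Qed.

Lemma infinity_val_X A : A != 0 -> v (X A) = v (X 'X) *+ (size A).-1.
Proof.
elim/poly_ind: A => [|A c IH]; first by rewrite eqxx.
have [->|A0] := eqVneq A 0.
  rewrite mul0r add0r polyC_eq0 size_polyC => c0.
  by rewrite c0 (dval_cst vP c0).
move=> _; rewrite size_MXaddC (negPf A0) /= rmorphD rmorphM.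
have E : v (X A * X 'X) = v (X 'X) *+ (size A).
  have IHA : v (X A) = v (X 'X) *+ (size A).-1 by exact: IH.
  by rewrite (dvalM vP) ?X_eq0 ?polyX_eq0 // IHA addrC -mulrS prednK ?size_poly_gt0.
have [||_ ->] := dval_addl vP (z := X A * X 'X) (w := X c%:P) => //.
  by rewrite (dom_mul_neq0 K_dom) ?X_eq0 ?polyX_eq0.
apply: vgeW (vge_cst vP c); rewrite E.
have : (0 < size A)%N by rewrite size_poly_gt0.
by move: v_inf; case: (size A) => // n; rewrite mulrS -[_ *+ n]mulr_natr; nia.
Qed.

(** The product y (y + h) = f has order (2g + 1) v(x). If v(y) < g v(x), then y + h has the same
    order as y. Otherwise both factors have order at least g v(x), and the product has order at
    least 2g v(x) > (2g + 1) v(x), which is absurd. *)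
Lemma infinity_val_y : v y *+ 2 = v (X 'X) *+ (2 * g + 1).
Proof.
have y0 : y != 0 by rewrite fnY fn_eq0 oner_eq0 andbF.
have yh0 : y + X h != 0 by rewrite fnX fnY fnD fn_eq0 addr0 oner_eq0 andbF.
have E : y * (y + X h) = X f by rewrite -yE; ring.
have vf : v y + v (y + X h) = v (X 'X) *+ (2 * g + 1).
  by rewrite -(dvalM vP) // E infinity_val_X ?f_neq0 // size_f addn2 addn1.
have vh : vge v (v (X 'X) *+ g) (X h).
  have [->|h0] := eqVneq h 0; first by rewrite rmorph0; apply: vge0.
  right; rewrite (infinity_val_X h0) ler_wnMn2l ?(ltW v_inf) //.
  by move: size_h; clear; lia.
have [yg|yg] := ltP (v y) (v (X 'X) *+ g).
  have [||_ e] := dval_addl vP (z := y) (w := X h) => //.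
    by apply: vgeW vh; rewrite lezD1.
  by rewrite -vf e mulr2n.
have : v (X 'X) *+ g <= v (y + X h).
  by apply: (vge_neq0 yh0); apply: (vgeD vP) => //; right.
rewrite mulrnDr mulr1n mulnC mulrnA mulr2n in vf.
move: (v (X 'X) *+ g) (v y) (v (y + X h)) (v (X 'X)) vf yg v_inf.
by clear; lia.
Qed.

Let val_delta A B : fn A B != 0 -> v (fn A B) *+ 2 = v (X 'X) *+ (delta A B).
Proof.
have y0 : y != 0 by rewrite fnY fn_eq0 oner_eq0 andbF.
have XE C : C != 0 -> v (X C) *+ 2 = v (X 'X) *+ (2 * (size C).-1).
  by move=> C0; rewrite infinity_val_X // -mulrnA mulnC.
have XyE C : C != 0 -> v (X C * y) *+ 2 = v (X 'X) *+ (2 * (size C).-1 + 2 * g + 1).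
  move=> C0; rewrite (dvalM vP) ?X_eq0 // mulrnDl XE // infinity_val_y.
  by rewrite -mulrnDr addnA.
rewrite fn_eq0 /delta /fn.
have [->|B0] := eqVneq B 0.
  by rewrite rmorph0 mul0r addr0 andbT maxn0; apply: XE.
have [->|A0 _] := eqVneq A 0.
  by move=> _; rewrite rmorph0 add0r size_poly0 muln0 max0n XyE.
have XA0 : X A != 0 by rewrite X_eq0.
have XB0 : X B * y != 0 by rewrite (dom_mul_neq0 K_dom) ?X_eq0.
have vA := XE _ A0; have vB := XyE _ B0.
have [AB|BA] := ltnP (2 * (size A).-1) (2 * (size B).-1 + 2 * g + 1).
  rewrite addrC; have [||_ ->] := dval_addl vP (z := X B * y) (w := X A) => //.
  by right; apply: double_lt_of_mulrn v_inf vA vB AB.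
have [||_ ->] := dval_addl vP (z := X A) (w := X B * y) => //.
right; apply: double_lt_of_mulrn v_inf vB vA _.
by move: BA; rewrite leq_eqVlt => /predU1P [|//]; clear; lia.
Qed.

Lemma infinity_val A B : fn A B != 0 -> v (fn A B) = - (delta A B)%:Z.
Proof.
(* Writing an element of order 1 as a quotient (A' + B' y) / C forces v(x) = -2. *)
have [t t0 t1] : exists2 t, t != 0 & v t = 1 by case: vP.
have [C [A' [B' [C0 CE]]]] := X_denom t.
have AB' : fn A' B' != 0 by rewrite -CE (dom_mul_neq0 K_dom) ?X_eq0.
have := val_delta AB'; rewrite -CE (dvalM vP) ?X_eq0 // t1 infinity_val_X //.
move=> e1; have e2 := infinity_val_y; rewrite mul2n addn1 in e2.
have v2 := eq_opp2_of_mulrn v_inf e2 e1.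
move=> /val_delta; rewrite v2; move: (v _) (delta _ _); clear => m d.
by rewrite !mulrn_int; lia.
Qed.

End Infinity.

(** * Existence of a valuation at an affine point *)

Section AffinePoint.

Variables a b : L.
Hypothesis ab : b ^+ 2 + h.[a] * b = f.[a].

Definition ev A B : L := A.[a] + B.[a] * b.

(** Values are only given to elements of L[x, y], by substitution of (a, b). *)
Definition takes z (c : L) := exists A B, z = fn A B /\ ev A B = c.

Lemma takes_fn A B : takes (fn A B) (ev A B).
Proof. by exists A, B. Qed.

Lemma takes_fun z c d : takes z c -> takes z d -> c = d.
Proof. by move=> [A [B [-> <-]]] [A' [B' [/fn_inj [-> ->] <-]]]. Qed.

Lemma takesM z w c d : takes z c -> takes w d -> takes (z * w) (c * d).
Proof.
move=> [A [B [-> <-]]] [A' [B' [-> <-]]]; rewrite fnM; do 2!eexists; split=> //.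
by rewrite /ev !(hornerD, hornerN, hornerM) -ab; ring.
Qed.

Lemma takesD z w c d : takes z c -> takes w d -> takes (z + w) (c + d).
Proof.
move=> [A [B [-> <-]]] [A' [B' [-> <-]]]; rewrite fnD; do 2!eexists; split=> //.
by rewrite /ev !hornerD; ring.
Qed.

Lemma takes_X A : takes (X A) A.[a].
Proof. by exists A, 0; rewrite fnX /ev horner0 mul0r addr0. Qed.

Lemma takes1 : takes 1 1.
Proof. by have := takes_X 1; rewrite rmorph1 hornerC. Qed.

Lemma takes_exp z c n : takes z c -> takes (z ^+ n) (c ^+ n).
Proof.
by move=> zc; elim: n => [|n IH]; [exact: takes1|rewrite !exprS; apply: takesM].
Qed.

Lemma takes_neq0 z c : c != 0 -> takes z c -> z != 0.
Proof.
move=> c0 zc; apply/eqP => z0; rewrite z0 in zc.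
have := takes_X 0; rewrite rmorph0 horner0 => /(takes_fun zc) e.
by rewrite e eqxx in c0.
Qed.

(** The elements of L[x, y] that are invertible in the local ring at (a, b). *)
Definition local_unit z := exists2 c, c != 0 & takes z c.

Lemma local_unit1 : local_unit 1.
Proof. by exists 1; [exact: oner_neq0|exact: takes1]. Qed.

Lemma local_unitM z w : local_unit z -> local_unit w -> local_unit (z * w).
Proof.
move=> [c c0 zc] [d d0 wd]; exists (c * d); first by rewrite mulf_neq0.
exact: takesM.
Qed.

Lemma local_unit_neq0 z : local_unit z -> z != 0.
Proof. by case=> c c0 /(takes_neq0 c0). Qed.

Section LocalParameter.

Variable t : K.
Hypothesis t0 : takes t 0.
Hypothesis t_neq0 : t != 0.
Hypothesis t_gen : forall A B, fn A B != 0 -> exists n U V,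
  [/\ local_unit U, local_unit V & U * fn A B = t ^+ n * V].

(** If m < n, cancelling t^m leaves U = t^(n - m) z, which vanishes at the point although U is a
    unit. *)
Lemma local_order_le m n U z c : local_unit U -> takes z c ->
  t ^+ m * U = t ^+ n * z -> (n <= m)%N.
Proof.
move=> [d d0 Ud] zc; rewrite leqNgt; apply: contraPN => mn.
rewrite -(subnK (ltnW mn)) addnC exprD -mulrA.
move/(dom_mulI K_dom (dom_exp_neq0 K_dom m t_neq0)) => e.
have := takesM (takes_exp (n - m) t0) zc; rewrite -e => /(takes_fun Ud).
by rewrite expr0n subn_eq0 leqNgt mn mul0r => /eqP; apply/negP.
Qed.

Let rho z (n : int) := exists i j U V, [/\ local_unit U, local_unit V,
  t ^+ i * U * z = t ^+ j * V & n = j%:Z - i%:Z].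

Lemma affine_valuation_ex :
  exists v, discrete_valuation xcst v /\ (forall U, local_unit U -> v U = 0) /\ v t = 1.
Proof.
have fun_rho z n m : z != 0 -> rho z n -> rho z m -> n = m.
  move=> z0 [i [j [U [V [U1 V1 E ->]]]]] [i' [j' [U' [V' [U'1 V'1 E' ->]]]]].
  have e : t ^+ (j + i') * (V * U') = t ^+ (j' + i) * (V' * U).
    transitivity ((t ^+ j * V) * (t ^+ i' * U')); first by rewrite exprD; ring.
    transitivity ((t ^+ j' * V') * (t ^+ i * U)); last by rewrite exprD; ring.
    by rewrite -E -E'; ring.
  have [c _ Vc] := local_unitM V1 U'1; have [d _ Vd] := local_unitM V'1 U1.
  have := local_order_le (local_unitM V1 U'1) Vd e.
  have := local_order_le (local_unitM V'1 U1) Vc (esym e); lia.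
have [|||||v [vP vE]] := valuation_of_graph K_dom (cst := xcst) (rho := rho) _ fun_rho.
- move=> z z0; have [C [A [B [C0 CE]]]] := X_denom z.
  have AB0 : fn A B != 0 by rewrite -CE (dom_mul_neq0 K_dom) ?X_eq0.
  have [n [U [V [U1 V1 E]]]] := t_gen AB0.
  have [|m [U' [V' [U'1 V'1 E']]]] := @t_gen C 0; first by rewrite -fnX X_eq0.
  exists (n%:Z - m%:Z), m, n, (V' * U), (V * U'); split; try exact: local_unitM.
    rewrite mulrA mulrA -E -CE -E' -fnX; ring.
  by [].
- move=> z w n m z0 w0 [i [j [U [V [U1 V1 E ->]]]]] [i' [j' [U' [V' [U'1 V'1 E' ->]]]]].
  exists (i + i')%N, (j + j')%N, (U * U'), (V * V'); split; try exact: local_unitM.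
    rewrite !exprD [RHS](_ : _ = (t ^+ j * V) * (t ^+ j' * V')); last by ring.
    by rewrite -E -E'; ring.
  by lia.
- move=> z w n m l z0 w0 zw0 [i [j [U [V [U1 V1 E ->]]]]].
  move=> [i' [j' [U' [V' [U'1 V'1 E' ->]]]]] [p [q [U2 [V2 [U21 V21 E2 ->]]]]] nm.
  have jj : (j + i' <= j' + i)%N by lia.
  have [c _ Vc] := V1; have [d _ V'd] := V'1; have [c1 _ Uc] := U1.
  have [d1 _ U'd] := U'1; have [c2 _ U2c] := U21.
  (* Over the common denominator t^(i + i') U U', the numerator of z + w is t^(j + i') times an
     element of L[x, y], because j + i' <= j' + i. *)
  have := local_order_le (local_unitM (local_unitM U1 U'1) V21)
     (takesM U2c (takesD (takesM Vc U'd)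
       (takesM (takes_exp (j' + i - (j + i')) t0) (takesM V'd Uc))))
     (m := (i + i' + q)%N) (n := (p + (j + i'))%N).
  have jjE : t ^+ (j + i') * t ^+ (j' + i - (j + i')) = t ^+ j' * t ^+ i.
    by rewrite -!exprD subnKC.
  suff e : t ^+ (i + i' + q) * (U * U' * V2) = t ^+ (p + (j + i')) *
      (U2 * (V * U' + t ^+ (j' + i - (j + i')) * (V' * U))) by move/(_ e); lia.
  rewrite (exprD _ p) [RHS](_ : _ = t ^+ p * U2 * (t ^+ (j + i') * (V * U') +
    t ^+ (j + i') * t ^+ (j' + i - (j + i')) * (V' * U))); last by ring.
  rewrite jjE [RHS](_ : _ = t ^+ p * U2 * ((t ^+ j * V) * (t ^+ i' * U') +
    (t ^+ j' * V') * (t ^+ i * U))); last by rewrite exprD; ring.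
  rewrite -E -E' [RHS](_ : _ = t ^+ (i + i') * (U * U') * (t ^+ p * U2 * (z + w))).
    by rewrite E2 exprD; ring.
  by rewrite exprD; ring.
- move=> c c0; exists 0%N, 0%N, 1, (xcst c); split=> //; first exact: local_unit1.
    by exists c => //; rewrite -[c in takes _ c](hornerC c a); apply: takes_X.
  by rewrite !expr0 !mul1r.
- exists t => //; exists 0%N, 1%N, 1, 1; split=> //; try exact: local_unit1.
  by rewrite expr0 expr1 !mul1r mulr1.
exists v; split=> //; split.
  move=> U U1; apply: vE; first exact: local_unit_neq0.
  exists 0%N, 0%N, 1, U; split=> //; first exact: local_unit1.
  by rewrite !expr0 !mul1r.
apply: vE => //; exists 0%N, 1%N, 1, 1; split=> //; try exact: local_unit1.
by rewrite expr0 expr1 !mul1r mulr1.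
Qed.

End LocalParameter.

Definition local_form t A B := exists n U V,
  [/\ local_unit U, local_unit V & U * fn A B = t ^+ n * V].

(** Common factors x - a of A and B are split off one at a time, each adding e to the exponent. This
    leaves the pairs whose two entries do not both vanish at a. *)
Lemma local_form_ind t e W W' : local_unit W -> local_unit W' ->
    W * X ('X - a%:P) = t ^+ e * W' ->
    (forall A B, ~ (A.[a] = 0 /\ B.[a] = 0) -> local_form t A B) ->
  forall A B, fn A B != 0 -> local_form t A B.
Proof.
move=> W1 W'1 WE base A B.
have [n] := ubnP (size A + size B); elim: n A B => // n IH A B sAB AB0.
have [/andP[]|/andP H] := boolP (root A a && root B a); last first.
  by apply: base => -[A0 B0]; apply: H; rewrite /root A0 B0 eqxx.
move=> /factor_theorem [A' AE] /factor_theorem [B' BE].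
have ABE : fn A B = X ('X - a%:P) * fn A' B' by rewrite fnZ AE BE !(mulrC _ ('X - _)).
have AB'0 : fn A' B' != 0.
  by apply: contraNN AB0 => /eqP e0; rewrite ABE e0 mulr0.
have sz (p q : {poly L}) : p = q * ('X - a%:P) ->
    (size q <= size p)%N /\ (q != 0 -> (size q < size p)%N).
  move=> ->; have [->|q0] := eqVneq q 0; first by rewrite mul0r leqnn.
  by rewrite size_Mmonic ?monicXsubC // size_XsubC addn2 ltnSn leqnSn.
have [|m [U [V [U1 V1 E]]]] := IH A' B' _ AB'0.
  have [sA sA'] := sz _ _ AE; have [sB sB'] := sz _ _ BE.
  move: AB'0; rewrite fn_eq0 negb_and => /orP [/sA'|/sB'];
  by move: sAB sA sB; clear; lia.
exists (e + m)%N, (W * U), (W' * V); split; try exact: local_unitM.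
transitivity ((W * X ('X - a%:P)) * (U * fn A' B')); first by rewrite ABE; ring.
by rewrite WE E exprD; ring.
Qed.

(** Suppose A + B y vanishes at (a, b) but A and B do not both vanish at a. The conjugate then has
    the nonzero value - B(a) (2 b + h(a)) there, so the order of A + B y is that of its norm, a
    polynomial in x. *)
Lemma local_form_unramified A B : 2 * b + h.[a] != 0 -> fn A B != 0 ->
  local_form (X ('X - a%:P)) A B.
Proof.
move=> ur; apply: (local_form_ind (e := 1) local_unit1 local_unit1).
  by rewrite expr1 mulrC.
move=> {}A {}B AB0; have [e0|e0] := eqVneq (ev A B) 0; last first.
  exists 0%N, 1, (fn A B); split; [exact: local_unit1| |by rewrite expr0].
  by exists (ev A B) => //; apply: takes_fn.
have A0 : A.[a] = - (B.[a] * b) by apply/eqP; rewrite -addr_eq0; apply/eqP.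
have B0 : B.[a] != 0.
  by apply/eqP => B0; apply: AB0; rewrite A0 B0 mul0r oppr0.
have n0 : nrm A B != 0.
  apply: nrm_neq0; rewrite fn_eq0; apply: contraNN B0 => /andP[_ /eqP ->].
  by rewrite horner0.
have [m [q q0 qE]] := multiplicity_XsubC (nrm A B) a.
rewrite n0 /= in q0.
exists m, (fn (A - B * h) (- B)), (X q); split.
- exists (ev (A - B * h) (- B)); last exact: takes_fn.
  rewrite /ev !(hornerD, hornerN, hornerM) A0 [X in X != 0](_ : _ = - (B.[a] * (2 * b + h.[a]))).
    by rewrite oppr_eq0 mulf_neq0.
  by ring.
- by exists q.[a] => //; apply: takes_X.
- by rewrite mulrC fn_conj qE rmorphM rmorphXn mulrC.
Qed.

(** The equation expanded around (a, b) is (y - b)^2 + (h + 2 b) (y - b) = f - b h - b^2. Both h + 2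
    b and the right-hand side vanish at a, which gives h1 and f1; smoothness is f1(a) = f'(a) - b
    h'(a) != 0. *)
Lemma ramified_parameter : 2 * b + h.[a] = 0 ->
  h^`().[a] * b - f^`().[a] != 0 ->
  exists f1 h1 : {poly L}, f1.[a] != 0 /\
    (X f1 - X h1 * (y - xcst b)) * X ('X - a%:P) = (y - xcst b) ^+ 2.
Proof.
move=> ra ns.
have /factor_theorem [f1 f1E] : root (f - b%:P * h - (b ^+ 2)%:P) a.
  by rewrite /root !(hornerD, hornerN, hornerM, hornerC) -ab; apply/eqP; ring.
have /factor_theorem [h1 h1E] : root (h + (2 * b)%:P) a.
  by rewrite /root !(hornerD, hornerC) addrC ra.
exists f1, h1; split.
  have := congr1 (fun p => p^`().[a]) f1E.
  rewrite derivM derivXsubC mulr1 !(derivB, derivM, derivC) !mul0r !add0r.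
  rewrite subr0 !(hornerD, hornerN, hornerM, hornerC, hornerX) subrr mulr0 add0r => <-.
  by rewrite -oppr_eq0 opprB mulrC.
rewrite mulrBl -mulrA (mulrC (y - _)) mulrA -!rmorphM -f1E -h1E.
rewrite !(rmorphB, rmorphD, rmorphM, rmorphXn) /= -yE /xcst /=; ring.
Qed.

Lemma local_form_ramified A B : 2 * b + h.[a] = 0 ->
  h^`().[a] * b - f^`().[a] != 0 -> fn A B != 0 ->
  local_form (y - xcst b) A B.
Proof.
move=> ra ns; have [f1 [h1 [f10 WE]]] := ramified_parameter ra ns.
have tt : takes (y - xcst b) 0.
  by exists (- b%:P), 1; rewrite /ev !hornerE addNr /fn rmorphN rmorph1 mul1r addrC.
have tW : takes (X f1 - X h1 * (y - xcst b)) f1.[a].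
  have := takesD (takes_X f1) (takesM (takes_X (- h1)) tt).
  by rewrite mulr0 addr0 rmorphN mulNr.
apply: (local_form_ind (e := 2) (W := X f1 - X h1 * (y - xcst b)) _ local_unit1).
- by exists f1.[a].
- by rewrite mulr1.
move=> {}A {}B AB0; have [e0|e0] := eqVneq (ev A B) 0; last first.
  exists 0%N, 1, (fn A B); split; [exact: local_unit1| |by rewrite expr0].
  by exists (ev A B) => //; apply: takes_fn.
have /factor_theorem [A1 A1E] : root (A + b%:P * B) a.
  by rewrite /root !(hornerD, hornerM, hornerC) mulrC; apply/eqP.
have B0 : B.[a] != 0.
  by apply/eqP => B0; apply: AB0; move: e0; rewrite /ev B0 mul0r addr0.
(* Multiplication by W = f1 - h1 (y - b) turns x - a into (y - b)^2. One factor y - b thus comes out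
   of W (A + B y), and the cofactor has value f1(a) B(a). *)
exists 1%N, (X f1 - X h1 * (y - xcst b)).
exists ((y - xcst b) * X A1 + (X f1 - X h1 * (y - xcst b)) * X B); split.
- by exists f1.[a].
- exists (0 * A1.[a] + f1.[a] * B.[a]); first by rewrite mul0r add0r mulf_neq0.
  by apply: takesD; apply: takesM => //; apply: takes_X.
have -> : fn A B = X ('X - a%:P) * X A1 + X B * (y - xcst b).
  by rewrite -rmorphM mulrC -A1E /fn rmorphD rmorphM /xcst /=; ring.
by rewrite mulrDr mulrA WE; ring.
Qed.

Hypothesis ab_smooth :
  ~ (2 * b + h.[a] = 0 /\ h^`().[a] * b - f^`().[a] = 0).

Lemma takes_Xx : takes (X ('X - a%:P)) 0.
Proof. by have := takes_X ('X - a%:P); rewrite hornerXsubC subrr. Qed.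

Lemma takes_yb : takes (y - xcst b) 0.
Proof.
by exists (- b%:P), 1; rewrite /ev !hornerE addNr /fn rmorphN rmorph1 mul1r addrC.
Qed.

Lemma yb_neq0 : y - xcst b != 0.
Proof.
have -> : y - xcst b = fn (- b%:P) 1 by rewrite /fn rmorphN rmorph1 mul1r addrC.
by rewrite fn_eq0 oner_eq0 andbF.
Qed.

Lemma Xx_neq0 : X ('X - a%:P) != 0.
Proof. by rewrite X_eq0 polyXsubC_eq0. Qed.

Definition ram_param : K :=
  if 2 * b + h.[a] == 0 then y - xcst b else X ('X - a%:P).

Lemma ram_param_neq0 : ram_param != 0.
Proof. by rewrite /ram_param; case: ifP; rewrite ?yb_neq0 ?Xx_neq0. Qed.

Lemma takes_ram_param : takes ram_param 0.
Proof. by rewrite /ram_param; case: ifP => _; [exact: takes_yb|exact: takes_Xx]. Qed.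

Lemma ram_param_form A B : fn A B != 0 -> local_form ram_param A B.
Proof.
rewrite /ram_param => AB0; case: eqP => [ra|/eqP ur]; last exact: local_form_unramified.
by apply: local_form_ramified => //; apply/eqP => ns; apply: ab_smooth.
Qed.

Lemma affine_val_ex : exists v,
  [/\ discrete_valuation xcst v, 0 < v (X 'X - xcst a) & 0 < v (y - xcst b)].
Proof.
have [v [vP [vU vt]]] :=
  affine_valuation_ex takes_ram_param ram_param_neq0 ram_param_form.
have pos A B : fn A B != 0 -> takes (fn A B) 0 -> 0 < v (fn A B).
  move=> AB0 AB; have [n [U [V [U1 V1 E]]]] := ram_param_form AB0.
  have : v (U * fn A B) = n%:Z.
    rewrite E (dvalM vP) ?(vU V) ?(dvalX K_dom vP) ?vt ?addr0 ?natz //.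
    - exact: ram_param_neq0.
    - by rewrite (dom_exp_neq0 K_dom) // ram_param_neq0.
    - exact: local_unit_neq0.
  rewrite (dvalM vP) ?(local_unit_neq0 U1) // (vU U) // add0r => ->.
  case: n E => // E; have [c _ Uc] := U1; have [d d0 Vd] := V1.
  have := takesM Uc AB; rewrite E expr0 mul1r mulr0 => /(takes_fun Vd) e.
  by rewrite e eqxx in d0.
exists v; split=> //.
  have := @pos ('X - a%:P) 0; rewrite -fnX => /(_ Xx_neq0 takes_Xx).
  by rewrite rmorphB.
have E : y - xcst b = fn (- b%:P) 1 by rewrite /fn rmorphN rmorph1 mul1r addrC.
by have := @pos (- b%:P) 1; rewrite -E => /(_ yb_neq0 takes_yb).
Qed.

(** * Orders for an arbitrary valuation centered at (a, b) *)

Variable v : K -> int.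
Hypothesis vP : discrete_valuation xcst v.
Hypothesis vx : 0 < v (X 'X - xcst a).
Hypothesis vy : 0 < v (y - xcst b).

Lemma vge_X A : vge v 0 (X A).
Proof.
elim/poly_ind: A => [|A c IH]; first by rewrite rmorph0; apply: vge0.
rewrite rmorphD rmorphM; apply: (vgeD vP); last exact: (vge_cst vP c).
rewrite -[0]addr0; apply: (vgeM vP) => //.
rewrite -(subrK (xcst a) (X 'X)); apply: (vgeD vP); last exact: (vge_cst vP a).
by right; apply: ltW.
Qed.

Lemma vge_fn A B : vge v 0 (fn A B).
Proof.
apply: (vgeD vP); first exact: vge_X.
rewrite -[0]addr0; apply: (vgeM vP); first exact: vge_X.
rewrite -(subrK (xcst b) y); apply: (vgeD vP); last exact: (vge_cst vP b).
by right; apply: ltW.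
Qed.

Lemma vge1_takes z c : takes z c -> vge v 1 (z - xcst c).
Proof.
move=> [A [B [-> <-]]].
have /factor_theorem [A' AE] : root (A - A.[a]%:P) a.
  by rewrite /root hornerD hornerN hornerC subrr.
have /factor_theorem [B' BE] : root (B - B.[a]%:P) a.
  by rewrite /root hornerD hornerN hornerC subrr.
have -> : fn A B - xcst (ev A B) =
    X ('X - a%:P) * fn A' B' + X B.[a]%:P * (y - xcst b).
  rewrite fnZ !(mulrC ('X - _)) -AE -BE /fn /ev /xcst /=.
  by rewrite !(rmorphB, rmorphD, rmorphM) /=; ring.
apply: (vgeD vP).
  rewrite -[1]addr0; apply: (vgeM vP); last exact: vge_fn.
  by right; rewrite rmorphB -gtz0_ge1.
rewrite -[1]add0r; apply: (vgeM vP); first exact: vge_X.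
by right; rewrite -gtz0_ge1.
Qed.

Lemma vge1_takes0 z : takes z 0 -> vge v 1 z.
Proof. by move=> /vge1_takes; rewrite rmorph0 subr0. Qed.

Lemma val_takes_unit z c : c != 0 -> takes z c -> v z = 0.
Proof.
move=> c0 /vge1_takes zc.
have xc0 : xcst c != 0 by rewrite fmorph_eq0.
have [||_] := dval_addl vP (z := xcst c) (w := z - xcst c) => //.
  by rewrite (dval_cst vP c0).
by rewrite addrC subrK (dval_cst vP c0).
Qed.

Lemma val_unit z : local_unit z -> v z = 0.
Proof. by case=> c c0; apply: val_takes_unit. Qed.

Lemma val_pos z c : z != 0 -> takes z c -> (0 < v z) = (c == 0).
Proof.
move=> z0 zc; have [c0|c0] := eqVneq c 0.
  by rewrite c0 in zc; rewrite gtz0_ge1 (vge_neq0 z0) //; apply: vge1_takes0.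
by rewrite (val_takes_unit c0 zc).
Qed.

Lemma val_local_form t A B n U V : t != 0 -> local_unit U -> local_unit V ->
  U * fn A B = t ^+ n * V -> fn A B != 0 -> v (fn A B) = v t *+ n.
Proof.
move=> t0 U1 V1 E AB0; have := congr1 v E.
rewrite !(dvalM vP) ?(local_unit_neq0 U1) ?(local_unit_neq0 V1) //; last first.
  exact: (dom_exp_neq0 K_dom).
by rewrite (val_unit U1) (val_unit V1) add0r addr0 (dvalX K_dom vP).
Qed.

(** Every order is a multiple of the order of the parameter, and 1 is an order. *)
Lemma val_ram_param : v ram_param = 1.
Proof.
have t0 := ram_param_neq0.
have pos : 0 < v ram_param by rewrite (val_pos t0 takes_ram_param).
have [z z0 z1] : exists2 z, z != 0 & v z = 1 by case: vP.
have [C [A [B [C0 CE]]]] := X_denom z.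
have XC0 : X C != 0 by rewrite X_eq0.
have AB0 : fn A B != 0 by rewrite -CE (dom_mul_neq0 K_dom).
have [n [U [V [U1 V1 E]]]] := ram_param_form AB0.
have [|m [U' [V' [U'1 V'1 E']]]] := @ram_param_form C 0; first by rewrite -fnX.
have := val_local_form t0 U1 V1 E AB0.
rewrite -CE (dvalM vP) // z1 fnX (val_local_form t0 U'1 V'1 E') -?fnX //.
move: pos; move: (v ram_param) => e; clear; rewrite !mulrn_int => e0 en.
have ei : e * (n%:Z - m%:Z) = 1 by rewrite mulrBr -en; ring.
have i0 : 0 < n%:Z - m%:Z by rewrite -(pmulr_rgt0 _ e0) ei.
have e1 : e <= 1 by rewrite -ei ler_peMr ?(ltW e0) // -gtz0_ge1.
by move: e0 e1; clear; lia.
Qed.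

Lemma val_unramified_X C : 2 * b + h.[a] != 0 -> C != 0 ->
  v (X C) = (mup a C)%:Z.
Proof.
move=> ur C0; have [m [q + ->]] := multiplicity_XsubC C a; rewrite C0 /= => q0.
rewrite mulrC mupMl // mup_XsubCX eqxx rmorphM rmorphXn (dvalM vP); last 2 first.
- by rewrite (dom_exp_neq0 K_dom) // Xx_neq0.
- by rewrite X_eq0; apply: contraNneq q0 => ->; rewrite root0.
have := val_ram_param; rewrite /ram_param (negPf ur) => e.
rewrite (dvalX K_dom vP) ?Xx_neq0 // e natz.
by rewrite (val_takes_unit q0 (takes_X q)) addr0.
Qed.

Lemma val_ramified_Xx : 2 * b + h.[a] = 0 -> v (X ('X - a%:P)) = 2.
Proof.
move=> ra; have ns : h^`().[a] * b - f^`().[a] != 0.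
  by apply/eqP => ns; apply: ab_smooth.
have [f1 [h1 [f10 WE]]] := ramified_parameter ra ns.
have tW : takes (X f1 - X h1 * (y - xcst b)) f1.[a].
  have := takesD (takes_X f1) (takesM (takes_X (- h1)) takes_yb).
  by rewrite mulr0 addr0 rmorphN mulNr.
have := congr1 v WE; rewrite (dvalM vP) ?Xx_neq0 ?(takes_neq0 f10 tW) //.
rewrite (val_takes_unit f10 tW) add0r (dvalX K_dom vP) ?yb_neq0 // => ->.
by have := val_ram_param; rewrite /ram_param ra eqxx => ->.
Qed.

Lemma val_ramified_X C : 2 * b + h.[a] = 0 -> C != 0 ->
  v (X C) = (2 * mup a C)%N%:Z.
Proof.
move=> ra C0; have [m [q + ->]] := multiplicity_XsubC C a; rewrite C0 /= => q0.
rewrite mulrC mupMl // mup_XsubCX eqxx rmorphM rmorphXn (dvalM vP); last 2 first.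
- by rewrite (dom_exp_neq0 K_dom) // Xx_neq0.
- by rewrite X_eq0; apply: contraNneq q0 => ->; rewrite root0.
rewrite (dvalX K_dom vP) ?Xx_neq0 // val_ramified_Xx //.
by rewrite (val_takes_unit q0 (takes_X q)) addr0 mulrn_int.
Qed.

(** In A + B y = B (y - b) + (x - a) A1 the second term has order at least 2, and the first has
    order exactly 1 unless B(a) = 0. *)
Lemma val_ramified_fn A B : 2 * b + h.[a] = 0 -> fn A B != 0 ->
  2 <= v (fn A B) -> A.[a] = 0 /\ B.[a] = 0.
Proof.
move=> ra AB0 v2.
have /eqP e0 : ev A B == 0 by rewrite -(val_pos AB0 (takes_fn A B)); lia.
suff B0 : B.[a] = 0 by split=> //; move: e0; rewrite /ev B0 mul0r addr0.
apply/eqP; apply: contraTT v2 => B0.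
have /factor_theorem [A1 A1E] : root (A + b%:P * B) a.
  by rewrite /root !(hornerD, hornerM, hornerC) mulrC; apply/eqP.
have E : fn A B = X B * (y - xcst b) + X ('X - a%:P) * X A1.
  by rewrite -rmorphM (mulrC (_ - _)) -A1E /fn rmorphD rmorphM /xcst /=; ring.
have vyb : v (y - xcst b) = 1.
  by have := val_ram_param; rewrite /ram_param ra eqxx.
have XB0 := takes_neq0 B0 (takes_X B).
have vB : v (X B * (y - xcst b)) = 1.
  by rewrite (dvalM vP) ?yb_neq0 // vyb (val_takes_unit B0 (takes_X B)).
have [||_] := dval_addl vP (z := X B * (y - xcst b)) (w := X ('X - a%:P) * X A1).
- by rewrite (dom_mul_neq0 K_dom) ?yb_neq0.
- rewrite vB -[1 + 1]addr0; apply: (vgeM vP); last exact: vge_X.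
  by right; rewrite val_ramified_Xx.
by rewrite -E vB => ->.
Qed.

End AffinePoint.

(** * Integral closedness of L[x, y] *)

Section Orders.

Let onc a b := b ^+ 2 + h.[a] * b = f.[a].

Hypothesis smooth : forall a b, onc a b ->
  ~ (2 * b + h.[a] = 0 /\ h^`().[a] * b - f^`().[a] = 0).

Variables (ordp : L -> L -> K -> int) (ordi : K -> int).
Hypothesis ordpP : forall a b, onc a b -> [/\ discrete_valuation xcst (ordp a b),
  0 < ordp a b (X 'X - xcst a) & 0 < ordp a b (y - xcst b)].
Hypothesis ordiP : discrete_valuation xcst ordi.
Hypothesis ordi_inf : ordi (X 'X) < 0.

Lemma onc_conj a b : onc a b -> onc a (- b - h.[a]).
Proof. by rewrite /onc => <-; ring. Qed.

Lemma onc_ex a : exists b, onc a b.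
Proof.
have [b] := @solve_monicpoly L 2 (fun i => if i == 0%N then f.[a] else - h.[a]) isT.
rewrite !big_ord_recl big_ord0 /= expr0 mulr1 addr0 expr1 => e; exists b.
by rewrite /onc e; ring.
Qed.

(** This is the case of the single denominator x - a. Above an unramified a there are two distinct
    points, and vanishing at both forces B(a) (2 b + h(a)) = 0; above a ramified a the order is at
    least 2. *)
Lemma regular_root A B a : fn A B != 0 ->
  (forall b, onc a b -> ordp a b (X ('X - a%:P)) <= ordp a b (fn A B)) ->
  A.[a] = 0 /\ B.[a] = 0.
Proof.
move=> AB0 H; have [b ab] := onc_ex a; have [vP vx vy] := ordpP ab.
have [ra|ur] := eqVneq (2 * b + h.[a]) 0.
  apply: (val_ramified_fn ab (smooth ab) vP vx vy ra AB0).
  by rewrite -(val_ramified_Xx ab (smooth ab) vP vx vy ra) H.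
have ev0 c : onc a c -> ev a c A B = 0.
  move=> ac; have [cP cx cy] := ordpP ac; apply/eqP.
  rewrite -(val_pos cP cx cy AB0 (takes_fn a c A B)).
  apply: lt_le_trans (H c ac); rewrite rmorphB; exact: cx.
have := ev0 _ ab; have := ev0 _ (onc_conj ab); rewrite /ev => e1 e2.
have B0 : B.[a] = 0.
  have /eqP : B.[a] * (2 * b + h.[a]) = 0.
    by rewrite -[RHS](subrr 0) -{1}e2 -e1; ring.
  by rewrite mulf_eq0 (negPf ur) orbF => /eqP.
by move: e2; rewrite B0 mul0r addr0.
Qed.

Lemma val_X_ge a b C : onc a b -> C != 0 -> (mup a C)%:Z <= ordp a b (X C).
Proof.
move=> ab C0; have [vP vx vy] := ordpP ab.
have [ra|ur] := eqVneq (2 * b + h.[a]) 0.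
  by rewrite (val_ramified_X ab (smooth ab) vP vx vy ra C0) lez_nat mul2n -addnn leq_addl.
by rewrite (val_unramified_X ab (smooth ab) vP vx vy ur C0).
Qed.

Lemma integrally_closed C A B z : C != 0 -> X C * z = fn A B ->
  (forall a b, onc a b -> vge (ordp a b) 0 z) -> C %| A /\ C %| B.
Proof.
move=> + + zreg; have [n] := ubnP (size C); elim: n C A B => // n IH C A B sC C0 CE.
have [sC1|sC1] := eqVneq (size C) 1%N.
  have /eqp_dvdl CA : C %= 1 by rewrite -size_poly_eq1 sC1.
  by rewrite !CA !dvd1p.
have [a /factor_theorem [C' C'E]] := closed_rootP C sC1.
have [AB0|AB0] := eqVneq (fn A B) 0.
  by move/eqP: AB0; rewrite fn_eq0 => /andP[/eqP -> /eqP ->]; rewrite !dvdp0.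
have z0 : z != 0 by apply: contraNneq AB0 => z0; rewrite -CE z0 mulr0.
have C'0 : C' != 0 by apply: contraNneq C0 => C'0; rewrite C'E C'0 mul0r.
have s0 : X ('X - a%:P) != 0 by rewrite X_eq0 polyXsubC_eq0.
have [/factor_theorem [A' A'E] /factor_theorem [B' B'E]] :
    root A a /\ root B a.
  have [|A0 B0] := @regular_root A B a AB0; last by rewrite /root A0 B0 eqxx.
  move=> b ab; have [vP vx vy] := ordpP ab.
  rewrite -CE C'E rmorphM -mulrA (dvalM vP) ?X_eq0 ?(dom_mul_neq0 K_dom) //.
  rewrite (dvalM vP) // addrCA lerDl.
  rewrite addr_ge0 ?(vge_neq0 z0 (zreg _ _ ab)) //.
  by apply: le_trans (val_X_ge ab C'0).
have [| |CA CB] := IH C' A' B' _ C'0.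
- by move: sC; rewrite C'E size_Mmonic ?monicXsubC // size_XsubC addn2.
- apply: (dom_mulI K_dom s0); rewrite fnZ mulrA -rmorphM.
  by rewrite !(mulrC ('X - _)) -C'E -A'E -B'E.
by rewrite C'E A'E B'E !dvdp_mul.
Qed.

(** * The space L(D_(u,v) - Poo) over L *)

Section Mumford.

Variables u v : {poly L}.
Hypothesis u0 : u != 0.
Hypothesis uv : u %| v ^+ 2 + h * v - f.

Lemma mumford_onc a : root u a -> onc a v.[a].
Proof.
move=> /eqP ua; have /dvdpP [w /(congr1 (horner^~ a))] := uv.
rewrite !(hornerD, hornerN, hornerM) ua mulr0 => /eqP.
by rewrite subr_eq0 => /eqP.
Qed.

Lemma mumford_conj a b : root u a -> onc a b -> b != v.[a] ->
  b = - v.[a] - h.[a] /\ 2 * b + h.[a] != 0.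
Proof.
move=> ua ab bv; have va := mumford_onc ua.
have bE : b = - v.[a] - h.[a].
  have /eqP : (b - v.[a]) * (b + v.[a] + h.[a]) = 0.
    by rewrite -[RHS](subrr f.[a]) -{1}ab -va; ring.
  rewrite mulf_eq0 subr_eq0 (negPf bv) /= -addrA addr_eq0 => /eqP ->.
  by rewrite opprD.
split=> //; apply: contraNneq bv => e.
have -> : v.[a] = - b - h.[a] by rewrite bE; ring.
by rewrite -subr_eq0 -e; apply/eqP; ring.
Qed.

(** If (x - a)^2 divided u, the derivative of v^2 + h v - f would vanish at a. Since 2 v + h is 0
    there, this leaves h' v - f' = 0, against smoothness. *)
Lemma mumford_ramified a : root u a -> 2 * v.[a] + h.[a] = 0 -> mup a u = 1%N.
Proof.
move=> ua ra; apply/eqP; rewrite eqn_leq -XsubC_dvd // dvdp_XsubCl ua andbT.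
rewrite leqNgt mup_geq //; apply/negP => /dvdp_trans /(_ uv) /dvdpP [q qE].
apply: (smooth (mumford_onc ua)); split=> //.
have := congr1 (fun p => p^`().[a]) qE.
rewrite /= !expr2 !(derivXsubC, derivB, derivD, derivM).
rewrite !(hornerXsubC, hornerD, hornerN, hornerM, hornerC) !subrr.
rewrite !(mulr0, mul0r, addr0) => e; rewrite -[RHS]e.
rewrite -[LHS]addr0 -[X in _ + X](mul0r (v^`().[a])) -ra; ring.
Qed.

(** The function y + v + h, which is minus the conjugate of y - v. *)
Definition conj_fn := fn (v + h) 1.

(** The product (y + v + h) (y - v) is a multiple of u, and y - v is a unit at the conjugate point,
    so the first factor carries the whole multiplicity. *)
Lemma val_conj_fn a b : root u a -> onc a b -> b != v.[a] ->
  vge (ordp a b) (mup a u)%:Z conj_fn.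
Proof.
move=> ua ab bv; have [bE ur] := mumford_conj ua ab bv; have [vP vx vy] := ordpP ab.
have [w wE] := dvdpP _ _ uv.
have E : conj_fn * fn (- v) 1 = X (- w * u).
  by rewrite mulNr -wE /conj_fn fnM fnX; congr fn; ring.
have U0 : ev a b (- v) 1 != 0 by rewrite /ev hornerN hornerC mul1r addrC subr_eq0.
have c0 : conj_fn != 0 by rewrite fn_eq0 oner_eq0 andbF.
have U1 := takes_neq0 U0 (takes_fn a b _ _).
have wu0 : - w * u != 0 by rewrite -X_eq0 -E (dom_mul_neq0 K_dom).
right; have := congr1 (ordp a b) E.
rewrite (dvalM vP) // (val_takes_unit vP vx vy U0 (takes_fn a b _ _)) addr0 => ->.
rewrite (val_unramified_X ab (smooth ab) vP vx vy ur wu0) lez_nat mupM ?leq_addl //.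
by apply: contraNneq wu0 => ->; rewrite mul0r.
Qed.

Definition mumford_coef a b : nat := if b == v.[a] then mup a u else 0%N.

Lemma val_X_ge_coef a b : onc a b -> (mumford_coef a b)%:Z <= ordp a b (X u).
Proof.
move=> ab; apply: le_trans (val_X_ge ab u0).
by rewrite /mumford_coef lez_nat; case: ifP.
Qed.

Lemma dvdp_of_mup (p q : {poly L}) : p != 0 -> q != 0 ->
  (forall a, root p a -> (mup a p <= mup a q)%N) -> p %| q.
Proof.
have [n] := ubnP (size p); elim: n p q => // n IH p q sp p0 q0 H.
have [sp1|sp1] := eqVneq (size p) 1%N.
  have /eqp_dvdl -> : p %= 1 by rewrite -size_poly_eq1 sp1.
  exact: dvd1p.
have [a pa] := closed_rootP p sp1.
have qa : root q a.
  by rewrite -dvdp_XsubCl XsubC_dvd // (leq_trans _ (H a pa)) // -XsubC_dvd // dvdp_XsubCl.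
have [p' pE] := factor_theorem _ _ pa; have [q' qE] := factor_theorem _ _ qa.
have p'0 : p' != 0 by apply: contraNneq p0 => e; rewrite pE e mul0r.
have q'0 : q' != 0 by apply: contraNneq q0 => e; rewrite qE e mul0r.
rewrite pE qE dvdp_mul // IH //.
  by move: sp; rewrite pE size_Mmonic ?monicXsubC // size_XsubC addn2.
move=> c pc; have := H c; rewrite pE qE rootM pc => /(_ isT).
by rewrite !mupM ?polyXsubC_eq0 // leq_add2r.
Qed.

Hypothesis g_gt0 : (0 < g)%N.
Hypothesis size_u : (g < size u)%N.

Definition RR z := z = 0 \/
  (forall a b, onc a b -> 0 <= ordp a b z + (mumford_coef a b)%:Z) /\ 1 <= ordi z.

(** The degree bounds say that u has a pole of larger order than r + B y at infinity: 2 deg r < 2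
    deg u and 2 deg B + 2g + 1 < 2 deg u. *)
Definition RR_form r B := [/\ u %| r - B * (v + h), (size r < size u)%N &
  (size B <= (size u).-1 - g)%N].

Lemma X_quot C A B z : C != 0 -> X C * z = fn A B ->
  (forall a b, onc a b -> vge (ordp a b) 0 (X u * z)) ->
  exists r B', [/\ u * A = r * C, u * B = B' * C & X u * z = fn r B'].
Proof.
move=> C0 CE reg.
have E : X C * (X u * z) = fn (u * A) (u * B) by rewrite mulrCA CE fnZ.
have [/dvdpP [r rE] /dvdpP [B' B'E]] := integrally_closed C0 E reg.
exists r, B'; split=> //; apply: (dom_mulI K_dom (z := X C)); first by rewrite X_eq0.
by rewrite E fnZ rE B'E !(mulrC C).
Qed.

Lemma RR_forward C A B z : C != 0 -> X C * z = fn A B -> RR z ->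
  exists r B', [/\ u * A = r * C, u * B = B' * C, X u * z = fn r B' & RR_form r B'].
Proof.
move=> C0 CE zR.
have Xu0 : X u != 0 by rewrite X_eq0.
have [z0|z0] := eqVneq z 0.
  exists 0, 0; move/eqP: CE; rewrite z0 mulr0 eq_sym fn_eq0 => /andP[/eqP -> /eqP ->].
  rewrite !mulr0 !mul0r fn0; split=> //; rewrite /RR_form mul0r subr0 dvdp0 !size_poly0.
  by split=> //; apply: leq_ltn_trans size_u.
case: zR => [/eqP|[zp zi]]; first by rewrite (negPf z0).
have uz0 : X u * z != 0 by rewrite (dom_mul_neq0 K_dom).
have reg a b : onc a b -> 0 <= ordp a b (X u * z).
  move=> ab; have [vP vx vy] := ordpP ab.
  rewrite (dvalM vP) // addrC; apply: le_trans (zp _ _ ab) _; rewrite lerD2l.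
  exact: val_X_ge_coef.
have [|r [B' [rE B'E uzE]]] := X_quot C0 CE; first by move=> a b /reg; right.
exists r, B'; split=> //.
have rB0 : fn r B' != 0 by rewrite -uzE.
have dl : (delta r B' < 2 * (size u).-1)%N.
  have := infinity_val ordiP ordi_inf rB0; rewrite -uzE (dvalM ordiP) //.
  have := @infinity_val _ ordiP ordi_inf u 0; rewrite -fnX => /(_ Xu0) ->.
  have -> : delta u 0 = (2 * (size u).-1)%N by rewrite /delta eqxx maxn0.
  by move: zi; move: (ordi z) (delta _ _) (_ * _)%N; clear; lia.
split.
- have [->|s0] := eqVneq (r - B' * (v + h)) 0; first exact: dvdp0.
  apply: dvdp_of_mup => // a ua; have va := mumford_onc ua.
  (* At a ramified root the multiplicity is 1 and v + h = - v, so it is enough that r + B' y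
     vanishes at the point. *)
  have [ra|ur] := eqVneq (2 * v.[a] + h.[a]) 0.
    rewrite (mumford_ramified ua ra) -XsubC_dvd // dvdp_XsubCl.
    have [vP vx vy] := ordpP va.
    have pos : 0 < ordp a v.[a] (X u * z).
      rewrite (dvalM vP) // (val_ramified_X va (smooth va) vP vx vy ra u0).
      have := zp _ _ va; rewrite /mumford_coef eqxx (mumford_ramified ua ra).
      by move: (ordp _ _ z); clear; lia.
    rewrite uzE in pos; rewrite (val_pos vP vx vy rB0 (takes_fn a v.[a] r B')) in pos.
    rewrite /root !(hornerD, hornerN, hornerM); move: pos; rewrite /ev => /eqP e.
    rewrite -[0]e; apply/eqP; rewrite -[LHS]addr0 -[X in _ + X](mulr0 (B'.[a])) -ra; ring.
  (* At an unramified root, r - B' (v + h) = (r + B' y) - B' (y + v + h) is examined at the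
     conjugate point. There z is regular, and both terms have order at least the multiplicity of a
     in u. *)
  have ab := onc_conj va; have [vP vx vy] := ordpP ab.
  have bv : - v.[a] - h.[a] != v.[a].
    apply: contraNneq ur => e; apply/eqP.
    by rewrite -[RHS](subrr v.[a]) -{3}e; ring.
  have [_ ur'] := mumford_conj ua ab bv.
  rewrite -lez_nat -(val_unramified_X ab (smooth ab) vP vx vy ur' s0).
  apply: (vge_neq0 (v := ordp a (- v.[a] - h.[a]))); first by rewrite X_eq0.
  have -> : X (r - B' * (v + h)) = fn r B' - X B' * conj_fn.
    by rewrite /conj_fn fnZ fnB fnX mulr1 subrr.
  apply: (vgeB vP); last first.
    rewrite -[(mup a u)%:Z]add0r; apply: (vgeM vP); first exact: vge_X vP vx B'.
    exact: val_conj_fn.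
  right; rewrite -uzE (dvalM vP) // -[X in X <= _]addr0 lerD ?val_X_ge //.
  by have := zp _ _ ab; rewrite /mumford_coef (negPf bv) addr0.
- move: dl; rewrite /delta gtn_max => /andP[+ _]; move: size_u.
  by move: (size r) (size u); clear => m n; lia.
- move: dl; rewrite /delta gtn_max => /andP[_].
  have [->|B'0] := eqVneq B' 0; first by rewrite size_poly0.
  by have : (0 < size B')%N by [rewrite size_poly_gt0]; move: size_u; clear; lia.
Qed.

Lemma RR_backward r B z : RR_form r B -> X u * z = fn r B -> RR z.
Proof.
move=> [/dvdpP [s sE] sr sB] uzE; have Xu0 : X u != 0 by rewrite X_eq0.
have [z0|z0] := eqVneq z 0; [by left|right].
have rB0 : fn r B != 0 by rewrite -uzE (dom_mul_neq0 K_dom).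
split=> [a b ab|].
  have [vP vx vy] := ordpP ab.
  have vz : ordp a b z = ordp a b (fn r B) - ordp a b (X u).
    by rewrite -uzE (dvalM vP) // addrAC subrr add0r.
  have rB_ge := vge_neq0 rB0 (vge_fn vP vx vy r B).
  have [ua|ua] := boolP (root u a); last first.
    by rewrite vz (val_takes_unit vP vx vy ua (takes_X a b u)) subr0 addr_ge0.
  (* In this form both terms vanish to the multiplicity of u at the conjugate point, which cancels
     the pole of 1 / u. *)
  have rBE : fn r B = X s * X u + X B * conj_fn.
    by rewrite -rmorphM -sE /conj_fn fnZ fnX fnD mulr1 add0r subrK.
  rewrite /mumford_coef; case: eqVneq => [bv|bv].
    have [ra|ur] := eqVneq (2 * b + h.[a]) 0.
      have ra' : 2 * v.[a] + h.[a] = 0 by rewrite -bv.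
      have m1 := mumford_ramified ua ra'.
      rewrite vz (val_ramified_X ab (smooth ab) vP vx vy ra u0) m1.
      suff : 0 < ordp a b (fn r B) by move: (ordp _ _ _); clear; lia.
      rewrite (val_pos vP vx vy rB0 (takes_fn a b r B)) /ev.
      have := congr1 (horner^~ a) sE; rewrite !(hornerD, hornerN, hornerM) (eqP ua) mulr0.
      move=> /subr0_eq ->; rewrite bv -mulrDr (_ : _ + _ + _ = 2 * v.[a] + h.[a]); last by ring.
      by rewrite ra' mulr0.
    by rewrite vz (val_unramified_X ab (smooth ab) vP vx vy ur u0) subrK.
  have [bE ur] := mumford_conj ua ab bv.
  rewrite addr0 vz (val_unramified_X ab (smooth ab) vP vx vy ur u0) subr_ge0.
  apply: (vge_neq0 rB0); rewrite rBE; apply: (vgeD vP).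
    rewrite -[(mup a u)%:Z]add0r; apply: (vgeM vP); first exact: vge_X vP vx s.
    by right; apply: val_X_ge.
  rewrite -[(mup a u)%:Z]add0r; apply: (vgeM vP); first exact: vge_X vP vx B.
  exact: val_conj_fn.
have dl : (delta r B < 2 * (size u).-1)%N.
  rewrite /delta gtn_max; apply/andP; split.
    by move: sr size_u g_gt0; move: (size r) (size u); clear => m n; lia.
  have [_|B0] := eqVneq B 0.
    by move: sr size_u g_gt0; move: (size r) (size u); clear => m n; lia.
  have : (0 < size B)%N by [rewrite size_poly_gt0]; move: sB size_u.
  by move: (size B) (size u); clear => m n; lia.
have := infinity_val ordiP ordi_inf rB0; rewrite -uzE (dvalM ordiP) //.
have := @infinity_val _ ordiP ordi_inf u 0; rewrite -fnX => /(_ Xu0) ->.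
have -> : delta u 0 = (2 * (size u).-1)%N by rewrite /delta eqxx maxn0.
by move: dl; move: (ordi z) (delta _ _) (_ * _)%N; clear; lia.
Qed.

End Mumford.

(** Above a root of u lie two distinct points, one in D_(u,v) and one in its conjugate, and x minus
    the root has order 1 at each. *)
Lemma val_X_unramified u v a b : u != 0 -> u %| v ^+ 2 + h * v - f ->
  (forall c, root u c -> 2 * v.[c] + h.[c] != 0) -> onc a b ->
  ordp a b (X u) = (mumford_coef u v a b + mumford_coef u (- v - h) a b)%N%:Z.
Proof.
move=> u0 uv ur ab; have [vP vx vy] := ordpP ab; rewrite /mumford_coef.
have [ua|ua] := boolP (root u a); last first.
  by rewrite mupNroot // !if_same (val_takes_unit vP vx vy ua (takes_X a b u)).
have urb : 2 * b + h.[a] != 0.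
  by have [->|/(mumford_conj uv ua ab) []//] := eqVneq b v.[a]; apply: ur.
rewrite (val_unramified_X ab (smooth ab) vP vx vy urb u0) !(hornerD, hornerN).
have [bv|/(mumford_conj uv ua ab) [-> _]] := eqVneq b v.[a]; last by rewrite eqxx.
rewrite [b == _](_ : _ = false) ?addn0 //; apply: contraNF urb => /eqP e.
by rewrite mulr_natl mulr2n {2}e bv; apply/eqP; ring.
Qed.

Lemma val_inf_X u : u != 0 -> ordi (X u) = - (2 * (size u).-1)%N%:Z.
Proof.
move=> u0; have Xu0 : X u != 0 by rewrite X_eq0.
have := @infinity_val _ ordiP ordi_inf u 0; rewrite -fnX => /(_ Xu0) ->.
by rewrite /delta eqxx maxn0.
Qed.

End Orders.

End FunctionField.

(** * Codes *)

Section Codes.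

Variables (F : finFieldType) (t : nat).
Hypothesis t_gt0 : (0 < t)%N.
Let n := (2 * t)%N.

Variable E : {linear 'rV[F]_t -> 'rV[F]_n}.
Hypothesis E_sep : forall (I : {set 'I_n}) x, #|I| = t ->
  (forall j, j \in I -> E x 0 j = 0) -> x = 0.

Definition weight (c : 'rV[F]_n) : nat := #|[set j | c 0 j != 0]|.

Lemma hammingE (c d : 'rV[F]_n) : hamming c d = weight (c - d).
Proof. by congr #|pred_of_set _|; apply/setP => j; rewrite !inE !mxE subr_eq0. Qed.

Lemma zeros_weight (c : 'rV[F]_n) : (#|[set j | c 0%R j == 0%R]| + weight c)%N = n.
Proof.
rewrite /weight -[RHS]card_ord -cardsT -(cardsID [set j | c 0 j == 0] setT) setTI.
by congr (_ + #|pred_of_set _|)%N; apply/setP => j; rewrite !inE andbT.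
Qed.

Lemma weight_ge x : x != 0 -> (t.+1 <= weight (E x))%N.
Proof.
move=> x0; have := zeros_weight (E x).
suff : (#|[set j | E x 0%R j == 0%R]| < t)%N.
  by rewrite /n; move: #|_| (weight _) => m k; clear; lia.
rewrite ltnNge; apply: contraNN x0 => /card_geqP [s [us sz ss]].
apply/eqP; apply: (E_sep (I := [set j in s])).
  by rewrite cardsE (card_uniqP us) sz.
by move=> j; rewrite inE => /ss; rewrite inE => /eqP.
Qed.

Lemma code_inj x : E x = 0 -> x = 0.
Proof.
move=> e; apply/eqP; apply: contraT => /weight_ge.
by rewrite e /weight; under eq_finset do rewrite mxE eqxx; rewrite cards0.
Qed.

Lemma weight_min : exists2 x, x != 0 & weight (E x) = t.+1.
Proof.
have lt : (t.-1 <= n)%N by rewrite /n; lia.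
(* A t by t - 1 matrix has a nonzero left kernel. A kernel vector gives a codeword with t - 1
   prescribed zeros, hence of weight at most t + 1. *)
pose N := colsub (widen_ord lt) (lin1_mx E) : 'M_(t, t.-1).
have kN : kermx N != 0.
  rewrite kermx_eq0 /row_free neq_ltn; apply/orP; left.
  by apply: leq_ltn_trans (rank_leq_col _) _; rewrite prednK.
pose x := nz_row (kermx N).
have x0 : x != 0 by rewrite nz_row_eq0.
have /sub_kermxP xN : (x <= kermx N)%MS by apply: nz_row_sub.
exists x => //; apply/eqP; rewrite eqn_leq weight_ge // andbT.
suff : (t.-1 <= #|[set j | E x 0%R j == 0%R]|)%N.
  have := zeros_weight (E x); move: t_gt0; rewrite /n.
  by move: #|_| (weight _) => m k; clear; lia.
rewrite -[X in (X <= _)%N]card_ord -(card_imset _ (f := widen_ord lt)); last first.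
  by move=> j k /(congr1 val) /= /val_inj.
apply: subset_leq_card; apply/subsetP => _ /imsetP [j _ ->]; rewrite inE.
by move: xN; rewrite mulmx_colsub mul_rV_lin1 => /matrixP /(_ 0 j); rewrite !mxE => ->.
Qed.

Variable C : {vspace 'rV[F]_n}.
Hypothesis C_E : forall c, c \in C <-> exists x, c = E x.

Let CE : C = limg (linfun E).
Proof.
apply/vspaceP => c; apply/idP/memv_imgP => [/C_E [x ->]|[x _ ->]].
  by exists x; rewrite ?memvf // lfunE.
by apply/C_E; exists x; rewrite lfunE.
Qed.

Lemma code_dim : \dim C = t.
Proof.
rewrite CE limg_dim_eq; first by rewrite dimvf dim_matrix mul1r.
apply/eqP; rewrite -subv0; apply/subvP => x /memv_capP [_].
by rewrite memv_ker lfunE memv0 => /eqP /code_inj ->.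
Qed.

Lemma code_parameters : parameters C t t.+1.
Proof.
split; first exact: code_dim.
split.
  have [x x0 wx] := weight_min; exists (E x), 0; split.
  - by apply/C_E; exists x.
  - exact: mem0v.
  - by apply: contraNneq x0 => /code_inj ->.
  - by rewrite hammingE subr0.
move=> c1 c2 /C_E [x ->] /C_E [x' ->] xx'.
rewrite hammingE -linearB weight_ge //; apply: contraNneq xx' => /eqP.
by rewrite subr_eq0 => /eqP ->.
Qed.

Lemma code_MDS : MDS C.
Proof.
exists t, t.+1; split; first exact: code_parameters.
by rewrite /n mul2n -addnn addnK addn1.
Qed.

End Codes.

Lemma LCP_of_disjoint (F : finFieldType) (t : nat) (C1 C2 : {vspace 'rV[F]_(2 * t)}) :
  \dim C1 = t -> \dim C2 = t -> (forall c, c \in C1 -> c \in C2 -> c = 0) ->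
  LCP C1 C2.
Proof.
move=> d1 d2 C120; have dir : directv (C1 + C2).
  apply/directv_addP/eqP; rewrite -subv0; apply/subvP => c /memv_capP [c1 c2].
  by rewrite memv0 (C120 c c1 c2).
split=> //; apply/eqP; rewrite eqEdim subvf (directvP dir) /= d1 d2 dimvf dim_matrix.
by rewrite mul1r addnn mul2n.
Qed.

(** * The codes in coordinates *)

Section Evaluation.

Variables (F : fieldType) (t : nat) (u w : {poly F}).
Variables (n : nat) (x y : 'I_n -> F).

(* With w = v + h, (residue b + b y) / u is the function of L(D_(u,v) - Poo)
   attached to the polynomial b. *)
Definition residue (b : {poly F}) : {poly F} := (b * w) %% u.

Definition eval_code (b : 'rV[F]_t) : 'rV[F]_n :=
  \row_j (((residue (rVpoly b)).[x j] + (rVpoly b).[x j] * y j) / u.[x j]).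

Lemma eval_code_linear : linear eval_code.
Proof.
move=> a b c; apply/rowP => j; rewrite !mxE /residue.
have -> : rVpoly (a *: b + c) = a *: rVpoly b + rVpoly c by rewrite linearP.
by rewrite [X in X %% _]mulrDl -scalerAl modpD modpZl !(hornerD, hornerZ); ring.
Qed.

HB.instance Definition _ :=
  GRing.isLinear.Build F 'rV[F]_t 'rV[F]_n _ eval_code eval_code_linear.

End Evaluation.

Lemma poly_eq0_of_roots (F : fieldType) (t : nat) (a : 'I_t -> F) (p : {poly F}) :
  injective a -> (size p <= t)%N -> (forall k, p.[a k] = 0) -> p = 0.
Proof.
move=> ai sp pa; apply/eqP; apply: contraLR sp => p0; rewrite -ltnNge.
have := @max_poly_roots _ p [seq a k | k <- enum 'I_t] p0.
rewrite size_map size_enum_ord; apply; last by rewrite map_inj_uniq ?enum_uniq.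
by apply/allP => _ /mapP [k _ ->]; apply/eqP.
Qed.

Lemma eval_code_disjoint (F : fieldType) (t n g : nat)
    (uA uB vA vB vG vH h : {poly F}) (x y : 'I_n -> F) (j1 j2 : 'I_t -> 'I_n)
    (b b' : 'rV[F]_t) :
  size uA = g.+1 -> size uB = t.+1 -> coprimep uB (2 *: vB + h) ->
  uA %| vG - vA -> uB %| vG - vB -> uA %| vH - vA -> uB %| vH - (- vB - h) ->
  (forall j, (uA * uB).[x j] != 0) ->
  (forall k, x (j1 k) = x (j2 k)) -> (forall k, y (j1 k) != y (j2 k)) ->
  injective (x \o j1) ->
  eval_code (uA * uB) (vG + h) x y b = eval_code (uA * uB) (vH + h) x y b' ->
  b = 0.
Proof.
move=> sA sB cop vGA vGB vHA vHB ux x12 y12 xi E.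
have uA0 : uA != 0 by rewrite -size_poly_gt0 sA.
have uB0 : uB != 0 by rewrite -size_poly_gt0 sB.
have u0 : uA * uB != 0 by rewrite mulf_neq0.
pose p := rVpoly b; pose p' := rVpoly b'.
pose s := residue (uA * uB) (vG + h) p - residue (uA * uB) (vH + h) p'.
have sj j : s.[x j] + (p - p').[x j] * y j = 0.
  have /rowP /(_ j) := E; rewrite !mxE => /(mulIf (invr_neq0 (ux j))) e.
  rewrite /s !(hornerD, hornerN) mulrBl.
  by rewrite addrACA -opprD; apply/eqP; rewrite subr_eq0; apply/eqP.
have pk k : (p - p').[x (j1 k)] = 0.
  have /eqP : (p - p').[x (j1 k)] * (y (j1 k) - y (j2 k)) = 0.
    have := sj (j1 k); have := sj (j2 k); rewrite -x12 => e2 e1.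
    by rewrite -[RHS](subrr 0) -{1}e1 -e2; ring.
  by rewrite mulf_eq0 subr_eq0 (negPf (y12 k)) orbF => /eqP.
have pp' : p = p'.
  apply/eqP; rewrite -subr_eq0; apply/eqP; apply: poly_eq0_of_roots xi _ pk.
  by rewrite -linearB size_poly.
have sk k : s.[x (j1 k)] = 0 by have := sj (j1 k); rewrite pk mul0r addr0.
(* Both residues are taken modulo u_A u_B of multiples of the same p, so h cancels in their
   difference. *)
have sE : uA * uB %| s - p * (vG - vH).
  have md q : uA * uB %| q - q %% (uA * uB).
    by rewrite {1}(divp_eq q (uA * uB)) addrK dvdp_mull.
  have := dvdp_sub (md (p * (vH + h))) (md (p * (vG + h))).
  rewrite /s -pp' /residue; congr (_ %| _).
  by move: (_ %% _) (_ %% _) => r1 r2; ring.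
have s0 : s = 0.
  have /dvdpP [s' s'E] : uA %| s.
    rewrite -(subrK (p * (vG - vH)) s) dvdp_add //.
      exact: dvdp_trans (dvdp_mulr _ (dvdpp _)) sE.
    apply: dvdp_mull; rewrite (_ : vG - vH = (vG - vA) - (vH - vA)); last by ring.
    exact: dvdp_sub.
  suff s'0 : s' = 0 by rewrite s'E s'0 mul0r.
  (* Since deg s < g + t and deg u_A = g, the cofactor s' has degree below t and vanishes at the t
     abscissas, where u_A does not. *)
  apply: (poly_eq0_of_roots xi) => [|k].
    have [->|s'0] := eqVneq s' 0; first by rewrite size_poly0.
    have : (size s < size (uA * uB)%R)%N.
      apply: leq_ltn_trans (size_polyD _ _) _; rewrite size_polyN gtn_max.
      by rewrite /residue !ltn_modp u0.
    rewrite s'E !size_mul // sA sB; have : (0 < size s')%N by rewrite size_poly_gt0.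
    by move: (size s') => m; clear; lia.
  have := sk k; rewrite s'E hornerM => /eqP; rewrite mulf_eq0.
  have := ux (j1 k); rewrite hornerM mulf_eq0 negb_or => /andP[/negPf -> _].
  by rewrite orbF => /eqP.
have uBp : uB %| p.
  (* Modulo u_B the difference v_G - v_H is 2 v_B + h, which is invertible. *)
  rewrite -(Gauss_dvdpl _ cop) (_ : p * _ = p * (vG - vH) -
    p * ((vG - vB) - (vH - (- vB - h)))); last by rewrite scaler_nat mulr2n; ring.
  apply: dvdp_sub; last by apply: dvdp_mull; apply: dvdp_sub.
  move: sE; rewrite s0 sub0r dvdpNr; apply: dvdp_trans.
  by apply: dvdp_mull; apply: dvdpp.
have sp : (size p <= t)%N by apply: size_poly.
have p0 : p = 0.
  by apply/eqP; apply: contraTT sp => /dvdp_leq /(_ uBp); rewrite sB -ltnNge.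
by rewrite -[b]rVpolyK -/p p0 linear0.
Qed.

(** * Coordinates on the function field *)

Lemma fraction_quot (R : idomainType) (x : {fraction R}) :
  exists n d, d != 0 /\ tofrac d * x = tofrac n.
Proof.
elim/quotW: x => r; exists (frac r).1, (frac r).2; split; first exact: denom_ratioP.
unlock FracField.tofrac; rewrite -[LHS]FracField.pi_mul; apply/eqP.
rewrite FracField.equivf_def /FracField.mulf !numden_Ratio ?mulf_neq0 ?oner_neq0 ?denom_ratioP //.
by rewrite mulr1 !mul1r mulrC.
Qed.

Lemma lin_poly_eq0 (R : nzRingType) (c d : R) :
  c%:P * 'X + d%:P = 0 -> c = 0 /\ d = 0.
Proof.
move=> /polyP e; split.
  by have := e 1%N; rewrite coef0 coefD coefMX !coefC /= addr0.
by have := e 0%N; rewrite coef0 coefD coefMX !coefC /= add0r.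
Qed.

Lemma size_lin_poly (R : nzRingType) (c d : R) : (size (c%:P * 'X + d%:P)%R <= 2)%N.
Proof. by rewrite size_MXaddC; case: ifP => // _; rewrite size_polyC; case: eqP. Qed.

Lemma lin_polyE (R : nzRingType) (p : {poly R}) : (size p <= 2)%N ->
  (p`_1)%:P * 'X + (p`_0)%:P = p.
Proof.
move=> sp; apply/polyP => -[|[|i]]; rewrite coefD coefMX !coefC /= ?add0r ?addr0 //.
by rewrite nth_default // (leq_trans sp).
Qed.

Lemma fn_common_denom (L : closedFieldType) (K : comNzRingType)
    (X : {rmorphism {poly L} -> K}) (y a b : K) (dr nr ds ns : {poly L}) :
  X nr = X dr * a -> X ns = X ds * b ->
  X (dr * ds) * (a + b * y) = fn X y (ds * nr) (dr * ns).
Proof. by move=> rE sE; rewrite /fn !rmorphM rE sE; ring. Qed.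

Definition coordX (L : closedFieldType) (K : comNzRingType)
    (m : {rmorphism base_field L -> K}) : {rmorphism {poly L} -> K} :=
  m \o @tofrac {poly L}.

Section FunfieldCoordinates.

Variables (F : finFieldType) (L : closedFieldType) (iota : {rmorphism F -> L}).
Variables h f : {poly F}.

Local Notation K := (funfield iota h f).
Local Notation Y := (yX iota h f).

Local Notation "p ^i" := (map_poly iota p) (at level 2, format "p ^i").

Local Notation ofX := (coordX (of_x iota h f)).

Lemma size_curve_poly : size (curve_poly iota h f) = 3.
Proof.
rewrite /curve_poly -addrA -polyCN size_polyDl ?size_polyXn //.
exact: leq_ltn_trans (size_lin_poly _ _) _.
Qed.

Lemma curve_poly_monic : curve_poly iota h f \is monic.
Proof.
rewrite /curve_poly -addrA -polyCN monicE lead_coefDl ?size_polyXn ?lead_coefXn //.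
exact: leq_ltn_trans (size_lin_poly _ _) _.
Qed.

(** The quotient is formed modulo [mk_monic], which keeps its argument only if it is monic and not
    constant. *)
Lemma mk_monic_curve_poly : mk_monic (curve_poly iota h f) = curve_poly iota h f.
Proof. by rewrite /mk_monic size_curve_poly curve_poly_monic. Qed.

Lemma yX_eq : Y ^+ 2 + ofX h^i * Y = ofX f^i.
Proof.
apply/eqP; rewrite -subr_eq0; apply/eqP.
have -> : Y ^+ 2 + ofX h^i * Y - ofX f^i =
    in_qpoly (curve_poly iota h f) (curve_poly iota h f).
  by rewrite {2}/curve_poly !(rmorphB, rmorphD, rmorphM, rmorphXn).
by apply: val_inj; rewrite /= mk_monic_curve_poly Pdiv.RingMonic.rmodpp // curve_poly_monic.
Qed.

Lemma of_x_lin (r s : base_field L) :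
  of_x iota h f r + of_x iota h f s * Y = s%:P * 'X + r%:P :> {poly _}.
Proof.
rewrite /of_x /yX -in_qpolyM -in_qpolyD in_qpoly_small ?mk_monic_curve_poly 1?addrC //.
by rewrite size_curve_poly; apply: size_lin_poly.
Qed.

Lemma of_x_free (r s : base_field L) :
  of_x iota h f r + of_x iota h f s * Y = 0 -> r = 0 /\ s = 0.
Proof.
move/(congr1 (fun z : K => polyn z)); rewrite of_x_lin.
by case/lin_poly_eq0 => -> ->.
Qed.

Lemma ofX_free A B : ofX A + ofX B * Y = 0 -> A = 0 /\ B = 0.
Proof. by move/of_x_free => -[/eqP + /eqP]; rewrite !tofrac_eq0 => /eqP -> /eqP ->. Qed.

Lemma ofX_inv C : C != 0 -> exists w, ofX C * w = 1.
Proof.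
move=> C0; exists (of_x iota h f (tofrac C)^-1).
by rewrite /coordX /= -rmorphM mulfV ?rmorph1 // tofrac_eq0.
Qed.

Lemma funfield_lin (z : K) : exists r s, z = of_x iota h f r + of_x iota h f s * Y.
Proof.
exists (polyn z)`_0, (polyn z)`_1; apply: val_inj.
rewrite [RHS]of_x_lin lin_polyE //.
have sz : (size (mk_monic (curve_poly iota h f)) <= 3)%N.
  by rewrite mk_monic_curve_poly size_curve_poly.
by have := leq_trans (size_mk_monic z) sz.
Qed.

Lemma ofX_denom (z : K) : exists C A B, C != 0 /\ ofX C * z = fn ofX Y A B.
Proof.
have [r [s ->]] := funfield_lin z.
have [nr [dr [dr0 rE]]] := fraction_quot r; have [ns [ds [ds0 sE]]] := fraction_quot s.
exists (dr * ds), (ds * nr), (dr * ns); rewrite mulf_neq0 //; split=> //.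
have scale d n (q : base_field L) : tofrac d * q = tofrac n ->
    ofX n = ofX d * of_x iota h f q.
  by move=> e; rewrite -[RHS](rmorphM (of_x iota h f)) e.
exact: fn_common_denom (scale _ _ _ rE) (scale _ _ _ sE).
Qed.

End FunfieldCoordinates.

(** * Divisors, Riemann-Roch spaces and codes of the curve *)

Lemma lin_scale (K : comNzRingType) (c p q y A B : K) :
  c * p = A -> c * q = B -> c * (p + q * y) = A + B * y.
Proof. by move=> <- <-; ring. Qed.

Lemma mem_roots (L : closedFieldType) (p : {poly L}) x :
  p != 0 -> (x \in Defs.roots p) = root p x.
Proof.
rewrite /Defs.roots mem_undup; case: closed_field_poly_normal => s /= {2}-> p0.
by rewrite rootZ ?lead_coef_eq0 // root_prod_XsubC.
Qed.

Section HyperellipticCurve.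

Variables (F : finFieldType) (L : closedFieldType) (iota : {rmorphism F -> L}).
Variables (h f : {poly F}) (g : nat).
Hypothesis hyp : hyperelliptic iota h f g.
Hypothesis g_gt0 : (0 < g)%N.

Local Notation "p ^i" := (map_poly iota p) (at level 2, format "p ^i").
Local Notation Poo := (Pinf iota h f).
Local Notation point := (curve_point iota h f).
Local Notation pt := (mkpoint iota h f).
Local Notation mdiv := (mumford_div iota h f).

(* K stands for funfield iota h f, on whose concrete structure conversion is
   intractable; ord below stands for Defs.ord. *)
Variables (K : comNzRingType) (m : {rmorphism base_field L -> K}) (Y : K).

Local Notation X := (coordX m).

Hypothesis yE : Y ^+ 2 + X h^i * Y = X f^i.
Hypothesis X_free : forall A B, X A + X B * Y = 0 -> A = 0 /\ B = 0.
Hypothesis X_inv : forall C, C != 0 -> exists w, X C * w = 1.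
Hypothesis X_denom : forall z, exists C A B, C != 0 /\ X C * z = fn X Y A B.

Let size_h : (size h^i <= g.+1)%N. Proof. by rewrite size_map_poly; case: hyp. Qed.
Let size_f : size f^i = (2 * g + 2)%N. Proof. by rewrite size_map_poly; case: hyp. Qed.

Definition onc (a b : L) := b ^+ 2 + h^i.[a] * b = f^i.[a].

Lemma on_curveP a b : reflect (onc a b) (on_curve iota h f (a, b)).
Proof. exact: eqP. Qed.

Lemma smooth_onc a b : onc a b ->
  ~ (2 * b + h^i.[a] = 0 /\ h^i^`().[a] * b - f^i^`().[a] = 0).
Proof. by move=> /on_curveP; case: hyp => _ _ _; apply. Qed.

Variable ord : point -> K -> int.
Hypothesis ordpP : forall a b, onc a b -> [/\ discrete_valuation (xcst X) (ord (pt a b)),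
  0 < ord (pt a b) (X 'X - xcst X a) & 0 < ord (pt a b) (Y - xcst X b)].
Hypothesis ordiP : discrete_valuation (xcst X) (ord Poo).
Hypothesis ordi_inf : ord Poo (X 'X) < 0.

Lemma coord_dom (z w : K) : z * w = 0 -> z = 0 \/ w = 0.
Proof. exact: (K_dom size_h size_f yE X_free X_inv X_denom). Qed.

Lemma coordX_eq0 C : (X C == 0) = (C == 0).
Proof. exact: (X_eq0 X_free). Qed.

Lemma point_cases (P : point) : P = Poo \/ exists a b, onc a b /\ P = pt a b.
Proof.
case: P => [p|]; [right|by left]; case: p => -[a b] ab; exists a, b.
by split; [exact/on_curveP|rewrite /mkpoint insubT].
Qed.

Lemma pt_inj a b a' b' : onc a b -> onc a' b' -> (pt a b == pt a' b') = ((a, b) == (a', b')).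
Proof.
by move=> /on_curveP ab /on_curveP ab'; rewrite /mkpoint !insubT -[LHS]val_eqE.
Qed.

Lemma pt_neq_inf a b : onc a b -> (pt a b == Poo) = false.
Proof. by move=> /on_curveP ab; rewrite /mkpoint insubT. Qed.

Lemma ord_discrete P : discrete_valuation (xcst X) (ord P).
Proof. by have [->//|[a [b [ab ->]]]] := point_cases P; case: (ordpP ab). Qed.

Lemma ordM P z w : z != 0 -> w != 0 -> ord P (z * w) = ord P z + ord P w.
Proof. by case: (ord_discrete P) => + _ _ _; apply. Qed.

Definition ratf z := exists a b c : {poly F}, c != 0 /\
  z = m (tofrac a^i / tofrac c^i) + m (tofrac b^i / tofrac c^i) * Y.

Lemma ratfP z : ratf z <->
  exists a b c : {poly F}, c != 0 /\ X c^i * z = fn X Y a^i b^i.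
Proof.
have quot (n d : {poly L}) : d != 0 -> X d * m (tofrac n / tofrac d) = X n.
  by move=> d0; rewrite /coordX /= -rmorphM mulrC mulfVK // tofrac_eq0.
split=> -[a [b [c [c0 zE]]]]; exists a, b, c; split=> //;
  have ci0 : c^i != 0 by [rewrite map_poly_eq0].
  by rewrite zE /fn; apply: lin_scale; apply: quot.
apply: (dom_mulI coord_dom (z := X c^i)); first by rewrite coordX_eq0.
by rewrite zE; apply/esym; apply: lin_scale; apply: quot.
Qed.

Lemma ratfM z w : ratf z -> ratf w -> ratf (z * w).
Proof.
move=> /ratfP [a [b [c [c0 zE]]]] /ratfP [a' [b' [c' [c'0 wE]]]].
apply/ratfP.
exists (a * a' + b * b' * f), (a * b' + b * a' - b * b' * h), (c * c').
rewrite mulf_neq0 //; split=> //.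
transitivity ((X c^i * z) * (X c'^i * w)); first by rewrite !rmorphM; ring.
by rewrite zE wE (fnM yE); congr (fn _ _ _ _); rewrite !(rmorphB, rmorphD, rmorphM).
Qed.

(* A Mumford pair without the condition on the degree of v, which the pair
   attached to the conjugate divisor may violate. *)
Definition semireduced (u v : {poly F}) := u != 0 /\ u %| v ^+ 2 + h * v - f.

Lemma mumford_semireduced u v : mumford h f u v -> semireduced u v.
Proof. by move=> [u1 _ uv]; split=> //; apply: monic_neq0. Qed.

Lemma semireduced_eqmod u v w : semireduced u v -> u %| w - v -> semireduced u w.
Proof.
move=> [u0 uv] wv; split=> //.
rewrite (_ : _ - f = (v ^+ 2 + h * v - f) + (w - v) * (w + v + h)); last by ring.
by rewrite dvdp_add // dvdp_mulr.
Qed.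

Lemma semireduced_conj u v : semireduced u v -> semireduced u (- v - h).
Proof.
move=> [u0 uv]; split=> //.
by rewrite (_ : _ - f = v ^+ 2 + h * v - f) //; ring.
Qed.

Lemma semireducedM u u' v : coprimep u u' ->
  semireduced u v -> semireduced u' v -> semireduced (u * u') v.
Proof. by move=> cop [u0 uv] [u'0 u'v]; split; rewrite ?mulf_neq0 // Gauss_dvdp // uv. Qed.

Lemma semireduced_lift u v : semireduced u v ->
  [/\ u^i != 0, u^i %| v^i ^+ 2 + h^i * v^i - f^i & size u^i = size u].
Proof.
move=> [u0 uv]; rewrite map_poly_eq0 u0 size_map_poly; split=> //.
have : u^i %| (v ^+ 2 + h * v - f)^i by rewrite dvdp_map.
by rewrite rmorphB rmorphD !rmorphM.
Qed.

Lemma coeff_mumford_div_inf u v : semireduced u v -> coeff Poo (mdiv u v) = 0.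
Proof.
move=> /semireduced_lift [u0 uv _]; rewrite /mumford_div raddf_sum big_seq big1 // => xi.
rewrite mem_roots // => xu; rewrite /= coeffU pt_neq_inf ?mulr0 //.
exact: mumford_onc uv _ xu.
Qed.

Lemma coeff_mumford_div u v a b : semireduced u v -> onc a b ->
  coeff (pt a b) (mdiv u v) = (mumford_coef u^i v^i a b)%:Z.
Proof.
move=> /semireduced_lift [u0 uv _] ab; rewrite /mumford_div raddf_sum /mumford_coef.
have -> : \sum_(xi <- Defs.roots u^i) coeff (pt a b) << (mup xi u^i)%:Z *g pt xi v^i.[xi] >> =
    \sum_(xi <- Defs.roots u^i | (xi == a)) (if b == v^i.[a] then mup a u^i else 0%N)%:Z.
  rewrite [RHS]big_mkcond big_seq [RHS]big_seq; apply: eq_bigr => xi.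
  rewrite mem_roots // => xu; rewrite coeffU pt_inj ?xpair_eqE //; last first.
    exact: mumford_onc uv _ xu.
  have [->|_] := eqVneq xi a; rewrite ?mulr0 // [b == _]eq_sym.
  by case: eqP => _; rewrite ?mulr1 ?mulr0.
have [ua|ua] := boolP (root u^i a).
  rewrite -big_filter (filter_pred1_uniq (s := Defs.roots u^i)) ?undup_uniq ?mem_roots //.
  by rewrite big_seq1.
rewrite big_seq_cond big1 => [|xi /andP[]].
  by rewrite mupNroot // if_same.
by rewrite mem_roots // => xu /eqP e; rewrite -e xu in ua.
Qed.

Definition RRs (G : divisor iota h f) z :=
  ratf z /\ (z = 0 \/ forall P, 0 <= ord P z + coeff P G).

Lemma RRs_RR u v z : semireduced u v -> RRs (mdiv u v - << Poo >>) z ->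
  RR h^i f^i (fun a b => ord (pt a b)) (ord Poo) u^i v^i z.
Proof.
move=> uvm [_ [->|zG]]; [by left|right]; split.
  move=> a b ab; have := zG (pt a b).
  by rewrite coeffB coeff_mumford_div // coeffU [Poo == _]eq_sym pt_neq_inf // mulr0 subr0.
by have := zG Poo; rewrite coeffB coeff_mumford_div_inf // coeffU eqxx sub0r mulr1 subr_ge0.
Qed.

Lemma RRs_forward u v z : semireduced u v -> (g < size u)%N ->
    RRs (mdiv u v - << Poo >>) z ->
  exists r b : {poly F}, [/\ X u^i * z = fn X Y r^i b^i,
    u %| r - b * (v + h), (size r < size u)%N & (size b <= (size u).-1 - g)%N].
Proof.
move=> uvm gu zR; have [u0 uv su] := semireduced_lift uvm.
have zR' := RRs_RR uvm zR; rewrite -su in gu.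
have [/ratfP [a [b [c [c0 zE]]]] _] := zR; have ci0 : c^i != 0 by rewrite map_poly_eq0.
have [r' [b' [rE bE uzE rf]]] := RR_forward size_h size_f yE X_free X_inv X_denom
  smooth_onc ordpP ordiP ordi_inf u0 uv gu ci0 zE zR'.
(* Descent to F: c divides u p over L, hence over F, and the quotient is unique. *)
have desc (p : {poly F}) (q : {poly L}) : u^i * p^i = q * c^i -> exists p', q = p'^i.
  move=> e; have /dvdpP [p' pE] : c %| u * p.
    by rewrite -(dvdp_map iota) rmorphM e dvdp_mull.
  by exists p'; apply: (mulIf ci0); rewrite -e -!rmorphM pE.
have [r rE'] := desc _ _ rE; have [b0 bE'] := desc _ _ bE.
exists r, b0; move: rf uzE; rewrite rE' bE' => -[d sr sb] uzE; split=> //.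
- by move: d; rewrite -rmorphD -rmorphM -rmorphB dvdp_map.
- by move: sr; rewrite !size_map_poly.
- by move: sb; rewrite !size_map_poly.
Qed.

Lemma RRs_backward u v (r b : {poly F}) : semireduced u v -> (g < size u)%N ->
  u %| r - b * (v + h) -> (size r < size u)%N -> (size b <= (size u).-1 - g)%N ->
  exists2 z, RRs (mdiv u v - << Poo >>) z & X u^i * z = fn X Y r^i b^i.
Proof.
move=> uvm gu d sr sb; have [u0 uv su] := semireduced_lift uvm.
have [w uw] := X_inv u0; pose z := w * fn X Y r^i b^i.
have uzE : X u^i * z = fn X Y r^i b^i by rewrite /z mulrA uw mul1r.
have zrat : ratf z.
  by apply/ratfP; exists r, b, u; split=> //; move: u0; rewrite map_poly_eq0.
exists z => //; split=> //.
have rf : RR_form h^i g u^i v^i r^i b^i.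
  split; rewrite ?size_map_poly //.
  by rewrite -rmorphD -rmorphM -rmorphB dvdp_map.
rewrite -su in gu.
have [z0|[zp zi]] := RR_backward size_h size_f yE X_free X_inv X_denom
  smooth_onc ordpP ordiP ordi_inf u0 uv g_gt0 gu rf uzE; [by left|right=> P].
have [->|[a [b' [ab ->]]]] := point_cases P.
  by rewrite coeffB coeff_mumford_div_inf // coeffU eqxx sub0r mulr1 subr_ge0.
rewrite coeffB coeff_mumford_div // coeffU [Poo == _]eq_sym pt_neq_inf //.
by rewrite mulr0 subr0; apply: zp.
Qed.

(** With deg u = g the degree bound leaves b = 0, and then u divides r, of smaller degree. *)
Lemma RRs_reduced0 u v z : semireduced u v -> size u = g.+1 ->
  RRs (mdiv u v - << Poo >>) z -> z = 0.
Proof.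
move=> uvm su; have u0 : u != 0 by case: uvm.
case/(RRs_forward uvm); first by rewrite su.
move=> r [b [uzE d sr]]; rewrite su subnn leqn0 size_poly_eq0 => /eqP b0.
move: d uzE; rewrite b0 mul0r subr0 => /dvdpP [q rE].
have -> : r = 0.
  by apply/eqP; apply: contraTT sr => r0; rewrite -leqNgt dvdp_leq // rE dvdp_mull.
rewrite rmorph0 fn0 => /coord_dom [/eqP|//].
by rewrite coordX_eq0 map_poly_eq0 (negPf u0).
Qed.

Definition linq (D E : divisor iota h f) := exists z,
  [/\ ratf z, z != 0 & forall P, coeff P (D - E) = ord P z].

Lemma linq_trans D E D' : linq D E -> linq E D' -> linq D D'.
Proof.
move=> [z [zr z0 zE]] [w [wr w0 wE]]; exists (z * w); split.
- exact: ratfM.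
- exact: (dom_mul_neq0 coord_dom).
by move=> P; rewrite ordM // -zE -wE -raddfD /= addrA subrK.
Qed.

Lemma linq_eq D D' E : (forall P, coeff P D = coeff P D') -> linq D' E -> linq D E.
Proof.
move=> e [z [zr z0 zE]]; exists z; split=> // P.
by rewrite -zE !coeffB e.
Qed.

(** The equivalence is realized by u. Coprimality with 2 v + h means that no point of D_(u,v) is
    ramified. *)
Lemma linq_conj u v (D E : divisor iota h f) : semireduced u v -> coprimep u (2 *: v + h) ->
    (forall P, coeff P (D - E) = coeff P (mdiv u v) + coeff P (mdiv u (- v - h))
      - (2 * (size u).-1)%N%:Z * (P == Poo)%:R) ->
  linq D E.
Proof.
move=> uvm cop DE; have uvm' := semireduced_conj uvm; have [u0 uv su] := semireduced_lift uvm.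
have ur c : root u^i c -> 2 * v^i.[c] + h^i.[c] != 0.
  have : coprimep u^i (2 *: v + h)^i by rewrite coprimep_map.
  move=> /coprimep_root H /H.
  by rewrite rmorphD hornerD /= map_polyZ hornerZ rmorphMn rmorph1.
exists (X u^i); split.
- by apply/ratfP; exists u, 0, 1; rewrite oner_neq0 !rmorph1 mul1r rmorph0 -fnX.
- by rewrite coordX_eq0.
move=> P; rewrite DE; have [->|[a [b [ab ->]]]] := point_cases P.
  rewrite !coeff_mumford_div_inf // eqxx mulr1 !add0r.
  by rewrite (val_inf_X size_h size_f yE X_free X_inv X_denom ordiP ordi_inf u0) su.
rewrite pt_neq_inf // mulr0 subr0 !coeff_mumford_div //.
rewrite (val_X_unramified size_h size_f yE X_free X_inv X_denom smooth_onc ordpP u0 uv ur ab).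
by rewrite !rmorphB rmorphN PoszD.
Qed.

Definition takes_value P z c := z = xcst X c \/ 0 < ord P (z - xcst X c).

Lemma takes_valueE a b u r B z c : onc a b -> u.[a] != 0 ->
  X u * z = fn X Y r B -> takes_value (pt a b) z c <-> r.[a] + B.[a] * b = c * u.[a].
Proof.
move=> ab ua uzE; have [vP vx vy] := ordpP ab.
have u0 : u != 0 by apply: contraNneq ua => ->; rewrite horner0.
have E : X u * (z - xcst X c) = fn X Y (r - c%:P * u) B.
  by rewrite mulrBr uzE /fn rmorphB rmorphM /xcst /=; ring.
have evE : ev a b (r - c%:P * u) B = r.[a] + B.[a] * b - c * u.[a].
  by rewrite /ev !(hornerD, hornerN, hornerM, hornerC); ring.
have [zc|zc] := eqVneq z (xcst X c).
  split=> _; last by left.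
  move: E; rewrite zc subrr mulr0 => /esym /X_free [e1 e2].
  by apply/eqP; rewrite -subr_eq0 -evE e1 e2 /ev !horner0 mul0r addr0.
have zc0 : z - xcst X c != 0 by rewrite subr_eq0.
have Xu0 : X u != 0 by rewrite coordX_eq0.
have fn0 : fn X Y (r - c%:P * u) B != 0 by rewrite -E (dom_mul_neq0 coord_dom).
have vE : ord (pt a b) (z - xcst X c) = ord (pt a b) (fn X Y (r - c%:P * u) B).
  by rewrite -E ordM // (val_takes_unit vP vx vy ua (takes_X X Y a b u)) add0r.
rewrite /takes_value vE (val_pos vP vx vy fn0 (takes_fn X Y a b _ _)) evE subr_eq0.
by split=> [[e|/eqP//]|->]; [rewrite e eqxx in zc|right].
Qed.

Definition cw n (R : 'I_n -> point) G (c : 'rV[F]_n) :=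
  exists2 z, RRs G z & forall j, takes_value (R j) z (iota (c 0 j)).

(** * Codewords of a Mumford divisor minus the point at infinity *)

Section Code.

Variables (n t : nat) (u v : {poly F}) (R : 'I_n -> point) (x y : 'I_n -> F).
Hypothesis uvm : semireduced u v.
Hypothesis size_u : size u = (g + t).+1.
Hypothesis R_onc : forall j, onc (iota (x j)) (iota (y j)).
Hypothesis RE : forall j, R j = pt (iota (x j)) (iota (y j)).
Hypothesis ux : forall j, u.[x j] != 0.

Let gu : (g < size u)%N. Proof. by rewrite size_u ltnS leq_addr. Qed.
Let ut : ((size u).-1 - g = t)%N. Proof. by rewrite size_u /= addKn. Qed.
Let u0 : u != 0. Proof. by rewrite -size_poly_gt0 size_u. Qed.

Lemma takes_value_residue (b : 'rV[F]_t) z (c : F) j :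
  X u^i * z = fn X Y (residue u (v + h) (rVpoly b))^i (rVpoly b)^i ->
  takes_value (R j) z (iota c) <-> c = eval_code u (v + h) x y b 0 j.
Proof.
move=> uzE; rewrite RE.
have ua : u^i.[iota (x j)] != 0 by rewrite horner_map fmorph_eq0.
rewrite (takes_valueE _ (R_onc j) ua uzE) !horner_map -!rmorphM -rmorphD mxE.
split=> [/fmorph_inj -> | ->]; first by rewrite mulfK.
by congr (iota _); rewrite divfK.
Qed.

Lemma cwP c : cw R (mdiv u v - << Poo >>) c <->
  exists b : 'rV[F]_t, c = eval_code u (v + h) x y b.
Proof.
split=> [[z zR zc]|[b ->]].
  have [r [b [uzE d sr sb]]] := RRs_forward uvm gu zR; rewrite ut in sb.
  exists (poly_rV b); apply/rowP => j; apply/(takes_value_residue _ (z := z)) => //.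
  rewrite poly_rV_K // /residue -[r in fn X Y r^i](modp_small sr) in uzE *.
  suff -> : (b * (v + h)) %% u = r %% u by [].
  by apply/eqP; rewrite -subr_eq0 -modpN -modpD -/(dvdp _ _) -opprB dvdpNr.
have [|||z zR uzE] := RRs_backward (r := residue u (v + h) (rVpoly b)) (b := rVpoly b) uvm gu.
- rewrite /residue {2}(divp_eq (rVpoly b * (v + h)) u) opprD addrCA subrr addr0 dvdpNr.
  exact: dvdp_mull.
- by rewrite ltn_modp.
- by rewrite ut; apply: size_poly.
by exists z => // j; apply/(takes_value_residue _ _ uzE).
Qed.

Lemma eval_code_sep (I : {set 'I_n}) (b : 'rV[F]_t) u' v' : injective R ->
  semireduced u' v' -> size u' = g.+1 ->
  linq (mdiv u v - \sum_(i in I) << R i >> - << g%:Z *g Poo >>)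
    (mdiv u' v' - << g%:Z *g Poo >>) ->
  (forall j, j \in I -> eval_code u (v + h) x y b 0 j = 0) -> b = 0.
Proof.
move=> Ri uvm' su' [w [wr w0 wE]] bI.
have [|||z zR uzE] := RRs_backward (r := residue u (v + h) (rVpoly b)) (b := rVpoly b) uvm gu.
- rewrite /residue {2}(divp_eq (rVpoly b * (v + h)) u) opprD addrCA subrr addr0 dvdpNr.
  exact: dvdp_mull.
- by rewrite ltn_modp.
- by rewrite ut; apply: size_poly.
suff z0 : z = 0.
  move: uzE; rewrite z0 mulr0 => /esym /X_free [_ /eqP].
  by rewrite map_poly_eq0 => /eqP b0; rewrite -[b]rVpolyK b0 linear0.
apply/eqP; apply: contraT => z0.
have zI j : j \in I -> 0 < ord (R j) z.
  move=> /bI /esym /(takes_value_residue _ _ uzE); rewrite /takes_value !rmorph0 subr0.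
  by case=> // e; rewrite e eqxx in z0.
suff : z * w = 0 by move/eqP; rewrite (negPf (dom_mul_neq0 coord_dom z0 w0)).
apply: (RRs_reduced0 uvm' su'); split; first by case: zR => zr _; apply: ratfM.
right=> P; rewrite ordM // -wE.
case: zR => _ [e|/(_ P)]; first by rewrite e eqxx in z0.
have cI : coeff P (\sum_(i in I) << R i >>) = (\sum_(i in I) (R i == P))%N%:Z.
  rewrite raddf_sum /= -[RHS]natz natr_sum; apply: eq_bigr => i _.
  by rewrite coeffU mul1r.
rewrite !coeffB cI; set cD := coeff P (mdiv u v); set cD' := coeff P (mdiv u' v').
(* At a point R_i with i in I, the zero of z makes up for the pole that w may have there, and
   D_(u,v) has coefficient 0 because u does not vanish at its abscissa. Elsewhere the bound is the
   one that z satisfies. *)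
have [/exists_inP [i iI /eqP Pi]|nP] := boolP [exists i in I, R i == P].
  have -> : (\sum_(i in I) (R i == P) = 1)%N.
    rewrite (bigD1 i) //= Pi eqxx big1 // => k /andP[_ ki].
    by rewrite -Pi (inj_eq Ri) (negPf ki).
  have -> : cD = 0.
    rewrite /cD -Pi RE coeff_mumford_div // /mumford_coef.
    by case: ifP => // _; rewrite mupNroot // /root horner_map fmorph_eq0.
  have := zI _ iI; rewrite Pi !coeffU -Pi RE [Poo == _]eq_sym pt_neq_inf //.
  rewrite !mulr0 -RE Pi; move: (ord P z) cD'; clear; lia.
have -> : (\sum_(i in I) (R i == P) = 0)%N.
  by rewrite big1 // => i iI; case: eqP => // e; case/exists_inP: nP; exists i => //; apply/eqP.
by move: (ord P z) cD cD' (coeff P _) (coeff P _); clear; lia.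
Qed.

End Code.

Lemma mumford_coef_eqmod (u v w : {poly F}) a b : u != 0 -> u %| w - v ->
  mumford_coef u^i w^i a b = mumford_coef u^i v^i a b.
Proof.
move=> u0 /dvdpP [q e]; rewrite /mumford_coef.
have [ua|ua] := boolP (root u^i a); last by rewrite mupNroot // !if_same.
suff -> : w^i.[a] = v^i.[a] by [].
apply/eqP; rewrite -subr_eq0 -hornerN -hornerD -rmorphB e rmorphM hornerM.
by rewrite (eqP ua) mulr0.
Qed.

Lemma coeff_mumford_divM (u u' v w w' : {poly F}) P : coprimep u u' ->
  semireduced u w -> semireduced u' w' -> u %| v - w -> u' %| v - w' ->
  coeff P (mdiv (u * u') v) = coeff P (mdiv u w) + coeff P (mdiv u' w').
Proof.
move=> cop uw u'w' vw vw'; have uv := semireduced_eqmod uw vw.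
have u'v := semireduced_eqmod u'w' vw'; have uu'v := semireducedM cop uv u'v.
have [->|[a [b [ab ->]]]] := point_cases P.
  by rewrite !coeff_mumford_div_inf.
have [u0 _] := uw; have [u'0 _] := u'w'.
rewrite !coeff_mumford_div // -(mumford_coef_eqmod a b u0 vw).
rewrite -(mumford_coef_eqmod a b u'0 vw') -PoszD rmorphM /mumford_coef.
by case: ifP => // _; rewrite mupM ?map_poly_eq0.
Qed.

Lemma involution_pt a b : onc a b -> involution (pt a b) = pt a (- b - h^i.[a]).
Proof.
move=> ab; have /on_curveP ab1 := ab; have /on_curveP ab2 := onc_conj ab.
by rewrite /mkpoint !insubT /=; congr Some; apply: val_inj.
Qed.

Lemma onc_above a b b' : onc a b -> onc a b' -> b' = b \/ b' = - b - h^i.[a].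
Proof.
move=> ab ab'; have /eqP : (b' - b) * (b' - (- b - h^i.[a])) = 0.
  by rewrite -[RHS](subrr f^i.[a]) -{1}ab' -ab; ring.
by rewrite mulf_eq0 !subr_eq0 => /orP [] /eqP; auto.
Qed.

(** The 2t labels (k, conjugate or not) map onto the 2t indices, hence bijectively. In particular no
    P_k is fixed by the involution. *)
Lemma conjugate_indices t (R : 'I_(2 * t) -> point) (P : 'I_t -> point) :
  injective R ->
  (forall S, (exists i, R i = S) <-> exists k, S = P k \/ S = involution (P k)) ->
  exists j1 j2, [/\ forall k, R (j1 k) = P k, forall k, R (j2 k) = involution (P k),
    injective j1 & forall k k', j1 k != j2 k'].
Proof.
move=> Ri RP.
have RPl k : exists j, R j = P k by apply/RP; exists k; left.
have RPr k : exists j, R j = involution (P k) by apply/RP; exists k; right.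
have [[j1 j1E] [j2 j2E]] := (fin_all_exists RPl, fin_all_exists RPr).
pose phi (kb : 'I_t * bool) := if kb.2 then j2 kb.1 else j1 kb.1.
have phi_onto i : exists kb, phi kb = i.
  have /RP [k [e|e]] : exists i', R i' = R i by exists i.
    by exists (k, false); apply: Ri; rewrite /phi /= j1E.
  by exists (k, true); apply: Ri; rewrite /phi /= j2E.
have [s sK] := fin_all_exists phi_onto.
have [|s' s'K Ks'] := inj_card_bij (can_inj sK).
  by rewrite card_prod card_bool !card_ord mulnC.
have phi_inj : injective phi by move=> p q; rewrite -(Ks' p) -(Ks' q) !sK => ->.
exists j1, j2; split=> // [k k' e|k k'].
  by have /phi_inj [] : phi (k, false) = phi (k', false) by [].
by apply/eqP => e; have /phi_inj [] : phi (k, false) = phi (k', true) by [].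
Qed.

(** * The two codes of the theorem *)

Section LCPCodes.

Variables (t : nat) (uA vA uB vB vG vH : {poly F}).
Hypothesis t_ge_g : (g <= t)%N.
Hypothesis A_mumford : mumford h f uA vA.
Hypothesis deg_uA : size uA = g.+1.
Hypothesis B_mumford : mumford h f uB vB.
Hypothesis deg_uB : size uB = t.+1.
Hypothesis coprime_uA_uB : coprimep uA uB.
Hypothesis coprime_uB : coprimep uB (2 *: vB + h).
Hypothesis vG_A : uA %| vG - vA.
Hypothesis vG_B : uB %| vG - vB.
Hypothesis vH_A : uA %| vH - vA.
Hypothesis vH_B : uB %| vH - (- vB - h).

Let A_semi := mumford_semireduced A_mumford.
Let B_semi := mumford_semireduced B_mumford.
Let B_conj := semireduced_conj B_semi.
Let G_semi : semireduced (uA * uB) vG.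
Proof.
by apply: semireducedM => //;
  [apply: semireduced_eqmod vG_A|apply: semireduced_eqmod vG_B].
Qed.
Let H_semi : semireduced (uA * uB) vH.
Proof.
by apply: semireducedM => //;
  [apply: semireduced_eqmod vH_A|apply: semireduced_eqmod vH_B].
Qed.
Let size_AB : size (uA * uB) = (g + t).+1.
Proof.
have [uA0 _] := A_semi; have [uB0 _] := B_semi.
by rewrite size_mul // deg_uA deg_uB addnS.
Qed.

Variables (R : 'I_(2 * t) -> point) (P : 'I_t -> point).
Hypothesis R_inj : injective R.
Hypothesis R_rat : forall i, rational_point (R i).
Hypothesis R_P :
  forall S, (exists i, R i = S) <-> exists k, S = P k \/ S = involution (P k).
Hypothesis R_G : forall i, R i \notin dom (mdiv (uA * uB) vG - << Poo >>).
Hypothesis R_inf : forall i, R i != Poo.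

Let alpha := mdiv uA vA - << g%:Z *g Poo >>.
Let beta := mdiv uB vB - << t%:Z *g Poo >>.
Let gamma (I : {set 'I_(2 * t)}) := \sum_(i in I) << R i >> - << t%:Z *g Poo >>.

(** By [RRs_reduced0], D + (g - 1) Poo then has no nonzero section, which in degree g - 1 means that
    it is nonspecial. *)
Definition nonspecial (D : divisor iota h f) := exists u v,
  [/\ mumford h f u v, size u = g.+1 & linq D (mdiv u v - << g%:Z *g Poo >>)].

Hypothesis nonspecial_I : forall I : {set 'I_(2 * t)}, #|I| = t ->
  nonspecial (alpha + beta - gamma I) /\ nonspecial (alpha - beta - gamma I).

Lemma coordinates_ex : exists x y, forall j,
  onc (iota (x j)) (iota (y j)) /\ R j = pt (iota (x j)) (iota (y j)).
Proof.
have ex j : exists p : F * F, onc (iota p.1) (iota p.2) /\ R j = pt (iota p.1) (iota p.2).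
  have := R_rat j; have := R_inf j.
  have [->|[a [b [ab ->]]]] := point_cases (R j); first by rewrite eqxx.
  move=> _; have /on_curveP ab' := ab; rewrite {1}/mkpoint insubT /= => -[x [y [ex ey]]].
  by exists (x, y); rewrite /= -ex -ey.
have [xy xyE] := fin_all_exists ex.
by exists (fun j => (xy j).1), (fun j => (xy j).2).
Qed.

Theorem AG_codes_LCP_MDS (CG CH : {vspace 'rV[F]_(2 * t)}) :
  (forall c, c \in CG <-> cw R (mdiv (uA * uB) vG - << Poo >>) c) ->
  (forall c, c \in CH <-> cw R (mdiv (uA * uB) vH - << Poo >>) c) ->
  [/\ LCP CG CH, MDS CG, MDS CH, parameters CG t t.+1 & parameters CH t t.+1].
Proof.
move=> CGE CHE; have t_gt0 : (0 < t)%N by apply: leq_trans t_ge_g.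
have [x [y xyE]] := coordinates_ex.
have R_onc j : onc (iota (x j)) (iota (y j)) by case: (xyE j).
have RE j : R j = pt (iota (x j)) (iota (y j)) by case: (xyE j).
have [j1 [j2 [j1E j2E j1i j12]]] := conjugate_indices R_inj R_P.
have j12E k : x (j1 k) = x (j2 k) /\
    iota (y (j2 k)) = - iota (y (j1 k)) - h^i.[iota (x (j1 k))].
  have := j2E k; rewrite -j1E !RE (involution_pt (R_onc _)) => /eqP.
  rewrite (pt_inj (R_onc _) (onc_conj (R_onc _))) => /eqP [ex ey].
  by split; [apply/esym/(fmorph_inj iota)|].
have Rxy i j : x i = x j -> y i = y j -> i = j.
  by move=> ex ey; apply: R_inj; rewrite !RE ex ey.
have closed j : exists j', R j' = pt (iota (x j)) (- iota (y j) - h^i.[iota (x j)]).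
  have /R_P [k [e|e]] : exists i, R i = R j by exists j.
    by exists (j2 k); rewrite j2E -e RE involution_pt.
  exists (j1 k); rewrite j1E; move: e; rewrite -(j1E k) !RE (involution_pt (R_onc _)).
  move/eqP; rewrite (pt_inj (R_onc _) (onc_conj (R_onc _))) => /eqP [-> ->].
  by congr pt; ring.
(* If u_A u_B vanished at x_j, then (x_j, v_G(x_j)) would lie in Supp(G). It is R_j or its
   conjugate, so it is also in the support of the evaluation divisor, which is stable under the
   involution. *)
have ux j : (uA * uB).[x j] != 0.
  have [u0 uv _] := semireduced_lift G_semi.
  rewrite -(fmorph_eq0 iota) -horner_map; apply/negP => ua.
  have va := mumford_onc uv ua.
  have [j' Rj'] : exists j', R j' = pt (iota (x j)) vG^i.[iota (x j)].
    by case: (onc_above (R_onc j) va) => ->; [exists j; rewrite RE|].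
  have := R_G j'; rewrite mem_dom negbK coeffB Rj' coeff_mumford_div //.
  rewrite coeffU [Poo == _]eq_sym pt_neq_inf // mulr0 subr0 /mumford_coef eqxx.
  by rewrite eqz_nat -leqn0 leqNgt -XsubC_dvd // dvdp_XsubCl /root ua.
have sepG (I : {set 'I_(2 * t)}) (b : 'rV[F]_t) : #|I| = t ->
    (forall j, j \in I -> eval_code (uA * uB) (vG + h) x y b 0 j = 0) -> b = 0.
  move=> /nonspecial_I [[u' [v' [uvm' su' lq]]] _].
  apply: (eval_code_sep G_semi size_AB R_onc RE ux R_inj (mumford_semireduced uvm') su').
  (* The multiples t Poo in beta and gamma cancel, so the two divisors are equal. *)
  apply: linq_eq lq => Q; rewrite /alpha /beta /gamma !(coeffB, coeffD).
  rewrite (coeff_mumford_divM Q coprime_uA_uB A_semi B_semi) //.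
  rewrite !coeffU; ring.
have sepH (I : {set 'I_(2 * t)}) (b : 'rV[F]_t) : #|I| = t ->
    (forall j, j \in I -> eval_code (uA * uB) (vH + h) x y b 0 j = 0) -> b = 0.
  move=> /nonspecial_I [_ [u' [v' [uvm' su' lq]]]].
  apply: (eval_code_sep H_semi size_AB R_onc RE ux R_inj (mumford_semireduced uvm') su').
  (* The two divisors differ by D_B + iota(D_B) - 2t Poo: one t comes from beta and the other from
     gamma. *)
  apply: linq_trans lq; apply: (linq_conj B_semi coprime_uB) => Q.
  rewrite /alpha /beta /gamma !(coeffB, coeffD).
  rewrite (coeff_mumford_divM Q coprime_uA_uB A_semi B_conj) //.
  rewrite !coeffU deg_uB /= PoszM [Poo == Q]eq_sym; ring.
pose EG : {linear 'rV[F]_t -> 'rV[F]_(2 * t)} := eval_code (uA * uB) (vG + h) x y.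
pose EH : {linear 'rV[F]_t -> 'rV[F]_(2 * t)} := eval_code (uA * uB) (vH + h) x y.
have CGP c : c \in CG <-> exists b : 'rV_t, c = eval_code (uA * uB) (vG + h) x y b.
  by rewrite CGE; apply: cwP.
have CHP c : c \in CH <-> exists b : 'rV_t, c = eval_code (uA * uB) (vH + h) x y b.
  by rewrite CHE; apply: cwP.
split.
- apply: LCP_of_disjoint.
  + exact: (code_dim (E := EG) sepG CGP).
  + exact: (code_dim (E := EH) sepH CHP).
  move=> c /CGP [b ->] /CHP [b' e].
  have -> : b = 0; last by rewrite linear0.
  apply: (eval_code_disjoint (j1 := j1) (j2 := j2) deg_uA deg_uB coprime_uB
    vG_A vG_B vH_A vH_B ux _ _ _ e).
  + by move=> k; case: (j12E k).
  + move=> k; apply/eqP => ey; have [ex _] := j12E k.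
    by have := j12 k k; rewrite (Rxy _ _ ex ey) eqxx.
  (* Points with the same abscissa are equal or conjugate; if conjugate, an index from [j1] would
     coincide with one from [j2]. *)
  + move=> k k' /= ex; apply: j1i.
    have ab' := R_onc (j1 k'); rewrite -ex in ab'.
    have [/fmorph_inj ey|ey] := onc_above (R_onc (j1 k)) ab'; first exact: Rxy.
    have [ex2 ey2] := j12E k.
    suff e2 : j1 k' = j2 k by have := j12 k' k; rewrite e2 eqxx.
    apply: Rxy; first by rewrite -ex.
    by apply: (fmorph_inj iota); rewrite ey2.
- exact: (code_MDS t_gt0 (E := EG) sepG CGP).
- exact: (code_MDS t_gt0 (E := EH) sepH CHP).
- exact: (code_parameters t_gt0 (E := EG) sepG CGP).
- exact: (code_parameters t_gt0 (E := EH) sepH CHP).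
Qed.

End LCPCodes.

End HyperellipticCurve.

(** * Transfer to the concrete function field and its orders *)

Section FunfieldOrders.

Variables (F : finFieldType) (L : closedFieldType) (iota : {rmorphism F -> L}).
Variables (h f : {poly F}) (g : nat).
Hypothesis hyp : hyperelliptic iota h f g.

Local Notation X := (coordX (of_x iota h f)).
Local Notation Y := (yX iota h f).
Local Notation hL := (map_poly iota h).
Local Notation fL := (map_poly iota f).

Let size_hL : (size hL <= g.+1)%N. Proof. by rewrite size_map_poly; case: hyp. Qed.
Let size_fL : size fL = (2 * g + 2)%N. Proof. by rewrite size_map_poly; case: hyp. Qed.
Let yE := yX_eq iota h f.
Let X_free := @ofX_free _ _ iota h f.
Let X_inv := @ofX_inv _ _ iota h f.
Let X_denom := @ofX_denom _ _ iota h f.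

Lemma xcst_cst c : xcst X c = cst iota h f c. Proof. reflexivity. Qed.

Lemma coordX_xX : X 'X = xX iota h f. Proof. reflexivity. Qed.

(** Without a valuation centered at P, [ord P] would be the default zero function. *)
Lemma ord_centered (P : curve_point iota h f) :
  (exists v, discrete_valuation (cst iota h f) v /\ centered P v) ->
  discrete_valuation (cst iota h f) (ord P) /\ centered P (ord P).
Proof.
move=> ex; exact: (@classical_sets.xgetPex _ (fun=> 0) (classical_sets.mkset
  (fun v => discrete_valuation (cst iota h f) v /\ centered P v)) ex).
Qed.

Lemma ord_affineP a b : onc iota h f a b ->
  [/\ discrete_valuation (xcst X) (ord (mkpoint iota h f a b)),
      0 < ord (mkpoint iota h f a b) (X 'X - xcst X a) &
      0 < ord (mkpoint iota h f a b) (Y - xcst X b)].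
Proof.
move=> ab; have /on_curveP ab' := ab.
have -> : mkpoint iota h f a b = Some (Sub (a, b) ab') by rewrite /mkpoint insubT.
have [v [vP vx vy]] :=
  affine_val_ex size_hL size_fL yE X_free X_inv X_denom ab (smooth_onc hyp ab).
rewrite coordX_xX !xcst_cst in vx vy *.
have ex : exists v, discrete_valuation (cst iota h f) v /\
    centered (Some (Sub (a, b) ab')) v.
  exists v; split; [exact: vP|split; [exact: vx|exact: vy]].
have [wP [wx wy]] := ord_centered ex.
split; [exact: wP|exact: wx|exact: wy].
Qed.

Lemma ord_infP : discrete_valuation (xcst X) (ord (Pinf iota h f)) /\
  ord (Pinf iota h f) (X 'X) < 0.
Proof.
have [v [vP vx]] := infinity_valuation_ex size_hL size_fL yE X_free X_inv X_denom.
rewrite coordX_xX in vx *.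
have ex : exists v, discrete_valuation (cst iota h f) v /\
    centered (Pinf iota h f) v.
  exists v; split; [exact: vP|exact: vx].
have [wP wx] := ord_centered ex.
split; [exact: wP|exact: wx].
Qed.

Lemma u_polynomialP (D : divisor iota h f) : (0 < g)%N ->
  size (u_polynomial g D) = g.+1 -> nonspecial g (of_x iota h f) Y (@ord _ _ iota h f) D.
Proof.
move=> g0; rewrite /u_polynomial /mumford_rep.
case: classical_sets.xgetP => [uv _ [[uvm _] lq]|_] /= su; last first.
  (* The default pair (1, 0) has a u-polynomial of degree 0, and g > 0. *)
  by move: su g0; rewrite size_poly1 => -[<-].
exists uv.1, uv.2; split; [exact: uvm|exact: su|].
rewrite su /= in lq; exact: lq.
Qed.

Lemma is_codewordE n (R : 'I_n -> curve_point iota h f) G c :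
  is_codeword R G c <-> cw (of_x iota h f) Y (@ord _ _ iota h f) R G c.
Proof. exact: iff_refl. Qed.

End FunfieldOrders.

Theorem theorem3
    (F : finFieldType) (L : closedFieldType) (iota : {rmorphism F -> L})
    (L_algebraic : integralRange iota)
    (g : nat) (h f : {poly F})
    (g_ge2 : (2 <= g)%N) (X : hyperelliptic iota h f g)
    (t : nat) (t_ge_g : (g <= t)%N)
    (uA vA uB vB : {poly F})
    (A_reduced : reduced_mumford h f g uA vA) (deg_uA : size uA = g.+1)
    (B_mumford : mumford h f uB vB) (deg_uB : size uB = t.+1)
    (coprime_uA_uB : coprimep uA uB)
    (coprime_uB : coprimep uB (2 *: vB + h))
    (vG vH : {poly F})
    (deg_vG : (size vG <= g + t)%N)
    (vG_A : uA %| vG - vA) (vG_B : uB %| vG - vB)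
    (deg_vH : (size vH <= g + t)%N)
    (vH_A : uA %| vH - vA) (vH_B : uB %| vH - (- vB - h))
    (R : 'I_(2 * t) -> curve_point iota h f)
    (P : 'I_t -> curve_point iota h f) :
  let Poo := Pinf iota h f in
  let G : divisor iota h f := mumford_div iota h f (uA * uB) vG - << Poo >> in
  let H : divisor iota h f := mumford_div iota h f (uA * uB) vH - << Poo >> in
  let alpha : divisor iota h f :=
    mumford_div iota h f uA vA - << g%:Z *g Poo >> in
  let beta : divisor iota h f :=
    mumford_div iota h f uB vB - << t%:Z *g Poo >> in
  let gamma (I : {set 'I_(2 * t)}) : divisor iota h f :=
    \sum_(i in I) << R i >> - << t%:Z *g Poo >> in
  injective R ->
  (forall i, rational_point (R i)) ->
  (forall S, (exists i, R i = S) <->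
             (exists k, S = P k \/ S = involution (P k))) ->
  (forall i, [/\ R i \notin dom G, R i \notin dom H & R i != Poo]) ->
  (forall I : {set 'I_(2 * t)}, #|I| = t ->
     size (u_polynomial g (alpha + beta - gamma I)) = g.+1 /\
     size (u_polynomial g (alpha - beta - gamma I)) = g.+1) ->
  [/\ LCP (AG_code R G) (AG_code R H),
      MDS (AG_code R G), MDS (AG_code R H),
      parameters (AG_code R G) t t.+1 &
      parameters (AG_code R H) t t.+1].
Proof.
move=> Poo G H alpha beta gamma R_inj R_rat R_P R_GH reps.
have g_gt0 : (0 < g)%N by apply: ltnW.
have [A_mumford _] := A_reduced.
have [ordiP ordi_inf] := ord_infP X.
apply: (AG_codes_LCP_MDS X g_gt0 (yX_eq iota h f) (@ofX_free _ _ iota h f)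
  (@ofX_inv _ _ iota h f) (@ofX_denom _ _ iota h f) (@ord_affineP _ _ _ _ _ _ X)
  ordiP ordi_inf t_ge_g A_mumford deg_uA B_mumford deg_uB coprime_uA_uB coprime_uB
  vG_A vG_B vH_A vH_B R_inj R_rat R_P).
- by move=> i; case: (R_GH i).
- by move=> i; case: (R_GH i).
- move=> I /reps [rG rH]; split; [exact: u_polynomialP rG|exact: u_polynomialP rH].
- by move=> c; rewrite AG_codeP; apply: is_codewordE.
- by move=> c; rewrite AG_codeP; apply: is_codewordE.
Qed.
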